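(* Let $M>0$, $h\in L^2(J)$ and $f\in L^2(I)$ with $f\notin\mathcal A^{\psi,b}|_I$. Then the solution $g_0$ of the bounded extremal problem $$\min_{g\in\mathcal B_{M,h}^{\psi,b}}\|\psi+bg-f\|_{L^2(I)}$$ is given by $$g_0=(1+\mu\phi)^{-1}P_+\left(\bar b(f-\psi)\vee(1+\mu)\bar b(h-\psi)\right),$$ where the parameter $\mu>-1$ is uniquely chosen such that $\|\psi+bg_0-h\|_{L^2(J)}=M$.
   Context: $\mathbb D$ is the open unit disk of $\mathbb C$ and $\mathbb T$ the unit circle. $\mathbb T=I\cup J$ where $I$ and $J=\mathbb T\setminus I$ are Lebesgue measurable sets, both of positive measure. $L^2$ spaces on $\mathbb T$, $I$, $J$ are taken with respect to the normalized measure $\frac{1}{2\pi}d\theta$. $H^2$ is the Hardy space of the disk, identified through boundary values with the closed subspace of $L^2(\mathbb T)$ of functions whose Fourier coefficients of negative index vanish; $P_+:L^2(\mathbb T)\to H^2$ is the orthogonal projection. For $u$ on $I$ and $v$ on $J$, $u\vee v$ denotes the function on $\mathbb T$ equal to $u$ on $I$ and to $v$ on $J$ (in such expressions, functions defined on all of $\mathbb T$ are restricted). $z_1,\dots,z_N\in\mathbb D$ are distinct points, $\omega_1,\dots,\omega_N\in\mathbb C$, $\psi\in H^2$ is a fixed function with $\psi(z_j)=\omega_j$ for all $j$, and $b(z)=e^{i\phi_0}\prod_{j=1}^N\frac{z-z_j}{1-\bar z_jz}$ ($\phi_0\in[0,2\pi]$ constant). Put $\mathcal A^{\psi,b}=\{\psi+bg:\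 g\in H^2\}$ and $\mathcal B_{M,h}^{\psi,b}=\{g\in H^2:\ \|\psi+bg-h\|_{L^2(J)}\le M\}$; $\mathcal A^{\psi,b}|_I$ is the set of restrictions (traces) to $I$ of elements of $\mathcal A^{\psi,b}$. $\phi:H^2\to H^2$, $\phi(F)=P_+(\chi_JF)$, is the Toeplitz operator with symbol the indicator function $\chi_J$; it is self-adjoint with spectrum contained in $[0,1]$, so $1+\mu\phi$ is boundedly invertible on $H^2$ for $\mu>-1$. *)

(* Defs.v *)
From mathcomp Require Export all_boot all_order all_algebra.
From mathcomp Require Export complex.
From mathcomp Require Export all_classical all_reals all_analysis.

Set Implicit Arguments.
Unset Strict Implicit.
Unset Printing Implicit Defensive.

Import Order.TTheory GRing.Theory Num.Theory numFieldNormedType.Exports.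

Local Open Scope classical_set_scope.
Local Open Scope ring_scope.

(* Functions on subsets of the unit circle are represented by functions
   R[i] -> R[i], whose values off the circle are irrelevant. Measure theory on
   the circle is Lebesgue measure theory for the angle t in [0, 2 pi[,
   normalized by (2 pi)^-1. An element of L^2 is represented by any
   square-integrable function in its class, and equality in L^2 is
   circle_ae_eq. *)

(* The real line with the sigma-algebra of Lebesgue-measurable (and not only
   Borel) sets, on which completed_lebesgue_measure is defined. *)
Notation lebesgueType R := (caratheodory_type ((@wlength R idfun)^*)%mu).

Section Circle.
Context {R : realType}.
Implicit Types (A I : set R[i]) (F G u v : R[i] -> R[i]).

Local Notation lambda := (@completed_lebesgue_measure R).

Definition circle : set R[i] := [set w | `|w| = 1].

Definition expi (t : R) : R[i] := (cos t +i* sin t)%C.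

Definition angles A : set (lebesgueType R) :=
  [set t : R | 0 <= t < 2 * pi /\ A (expi t)].

Definition circle_measurable A : Prop := measurable (angles A).

Definition circle_measure A : \bar R := (((2 * pi)^-1)%:E * lambda (angles A))%E.

Definition circle_ae_eq A F G : Prop :=
  {ae lambda, forall t, angles A t -> F (expi t) = G (expi t)}.

Definition circle_measurable_fun A F : Prop :=
  measurable_fun (angles A) (fun t => complex.Re (F (expi t))) /\
  measurable_fun (angles A) (fun t => complex.Im (F (expi t))).

Definition circle_integral A F : R[i] :=
  ((2 * pi)^-1 * \int[lambda]_(t in angles A) complex.Re (F (expi t))
   +i* ((2 * pi)^-1 * \int[lambda]_(t in angles A) complex.Im (F (expi t))))%C.

Definition L2 A : set (R[i] -> R[i]) :=
  [set F | circle_measurable_fun A F /\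
    (\int[lambda]_(t in angles A) (Normc.normc (F (expi t)) ^+ 2)%:E
       < +oo)%E].

Definition L2norm A F : R :=
  Num.sqrt ((2 * pi)^-1 *
    \int[lambda]_(t in angles A) (Normc.normc (F (expi t)) ^+ 2)).

Definition L2inner F G : R[i] := circle_integral circle (F \* (conjc \o G)).

Definition fourier F (n : int) : R[i] :=
  circle_integral circle (fun w => F w * w ^ (- n)).

Definition hardy : set (R[i] -> R[i]) :=
  [set F | L2 circle F /\ forall n : int, n < 0 -> fourier F n = 0].

(* The value at a point z of the open unit disk of the analytic function
   sum_k (fourier F k) z^k whose boundary function is F. *)
Definition hardy_eval F (z : R[i]) : R[i] :=
  let S n := \sum_(k < n) fourier F k%:Z * z ^+ k in
  (limn (fun n => complex.Re (S n)) +i* limn (fun n => complex.Im (S n)))%C.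

(* Orthogonal projection of L^2 onto H^2; a representative of the
   projection is picked. *)
Definition P_plus F : R[i] -> R[i] :=
  xget 0 [set p | hardy p /\ forall q, hardy q -> L2inner (F \- p) q = 0].

Definition toeplitz (J : set R[i]) F : R[i] -> R[i] := P_plus (\1_J \* F).

(* Inverse of an operator T : H^2 -> H^2; a representative of the preimage is
   picked. *)
Definition hardy_inv (T : (R[i] -> R[i]) -> R[i] -> R[i]) F : R[i] -> R[i] :=
  xget 0 [set g | hardy g /\ circle_ae_eq circle (T g) F].

Definition vee I u v : R[i] -> R[i] := fun w => if w \in I then u w else v w.

Definition blaschke (phi0 : R) (N : nat) (z : 'I_N -> R[i]) (w : R[i]) : R[i] :=
  expi phi0 * \prod_(j < N) ((w - z j) / (1 - conjc (z j) * w)).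

(* The traces on A of the elements of a set E of functions on the circle. *)
Definition trace A (E : set (R[i] -> R[i])) : set (R[i] -> R[i]) :=
  [set u | exists2 F, E F & circle_ae_eq A u F].

Definition Apsib psi b : set (R[i] -> R[i]) :=
  [set psi \+ b \* g | g in hardy].

Definition BMh (J : set R[i]) psi b (M : R) h : set (R[i] -> R[i]) :=
  [set g | hardy g /\ L2norm J (psi \+ b \* g \- h) <= M].

Definition BEP_solution (I J : set R[i]) psi b (M : R) h f g : Prop :=
  BMh J psi b M h g /\
  forall g', BMh J psi b M h g' ->
    L2norm I (psi \+ b \* g \- f) <= L2norm I (psi \+ b \* g' \- f).

End Circle.

(* Main.v *)
Require Import Defs.
From mathcomp Require Import ring lra measurable_realfun.
Import Order.TTheory GRing.Theory Num.Theory numFieldNormedType.Exports.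
Local Open Scope classical_set_scope.
Local Open Scope ring_scope.
Set Implicit Arguments.
Unset Strict Implicit.
Unset Printing Implicit Defensive.

(** A Blaschke product b has modulus one on the circle, so multiplying by its
conjugate turns psi + b g - f and psi + b g - h into g - k, where k is the
function equal to conj b (f - psi) on I and to conj b (h - psi) on J.  With
A(F) and B(F) the squared norms of F over I and over J, the problem is to
minimize A(g - k) over g in H^2 subject to B(g - k) <= M^2.

The function given by the formula of the theorem is the minimizer over H^2 of
the penalized functional A(g - k) + l B(g - k) with l = 1 + mu > 0: since the
projection P_+ is self-adjoint, (1 + mu phi) g = P_+(k on I, (1 + mu) k on J)
says exactly that A(g - k, v) + l B(g - k, v) = 0 for all v in H^2
([toeplitz_equation]).  Call g_l its solution and m(l) = B(g_l - k).
Subtracting the equations for l and l' and testing against d = g_l - g_l'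
gives
    2 A(d) + (l + l') B(d) = (l' - l) (m(l) - m(l')),
and everything about the multiplier comes out of this identity
([normal_eq_difference]): m decreases and is Lipschitz on each [a, +oo[; if m
takes the same value at two different l then d = 0, and this value is 0
because H^2 is dense in L^2(J); if m stays bounded as l -> 0 then g_l is
Cauchy, and its limit agrees with k on I because H^2 is dense in L^2(I), which
the hypothesis on f forbids.  As m(l) -> 0 when l -> +oo, the intermediate
value theorem gives exactly one l with m(l) = M^2, and for this l comparing
penalized functionals shows that g_l is the only solution of the constrained
problem.

Density of H^2 on a piece of the circle is dual to a uniqueness theorem: if u
on the piece is orthogonal to H^2, the conjugate of u extended by 0 is in H^2
and vanishes on the complement, which has positive measure.  An H^2 function
that vanishes on a set of positive measure is zero ([hardy_uniqueness]).  The
proof avoids log-integrability: the functions of H^2 vanishing on the set form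
a closed subspace K stable under the shift.  If K contained a function with a
nonzero Fourier coefficient, take the least index m at which this happens;
some phi in K with nonzero m-th coefficient is orthogonal to the members of K
whose m-th coefficient is zero, hence to z^n phi for all n >= 1.  So
all nonconstant Fourier coefficients of |phi|^2 vanish, |phi|^2 is constant,
and the constant is 0 since phi vanishes on the set.

This rests on two facts of measure theory: L^2 is complete
([square_integrable_complete]), and an integrable function is determined by
its trigonometric moments ([trigonometric_uniqueness]). *)

(** * Semi-inner products and projections *)

Section SemiInner.
Context {R : realType} {E : lmodType R}.
Implicit Types (L V C : set E) (B : E -> E -> R) (x y z k : E) (u : nat -> E).

Definition subspace V := V 0 /\ forall a x y, V x -> V y -> V (a *: x + y).

(** Degenerate forms are allowed, since functions are not identified almost
everywhere and the form over a piece ignores the rest of the circle. *)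
Record semi_inner L B : Prop := SemiInner {
  semi_innerC : forall x y, L x -> L y -> B x y = B y x ;
  semi_innerP : forall a x y z, L x -> L y -> L z ->
    B (a *: x + y) z = a * B x z + B y z ;
  semi_inner_ge0 : forall x, L x -> 0 <= B x x }.

(** Limits, Cauchy sequences and closures are taken for the seminorm of a form,
because one vector space carries several of them. *)
Definition converges_for B u x :=
  forall e, 0 < e -> exists n0, forall n, (n0 <= n)%N -> B (u n - x) (u n - x) < e.

Definition cauchy_for B u := forall e, 0 < e ->
  exists n0, forall m n, (n0 <= m)%N -> (n0 <= n)%N -> B (u m - u n) (u m - u n) < e.

Definition complete_for B C := forall u, (forall n, C (u n)) -> cauchy_for B u ->
  exists2 x, C x & converges_for B u x.

Definition dense_for B L V := forall y, L y -> forall e, 0 < e ->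
  exists2 v, V v & B (v - y) (v - y) < e.

Section Subspace.
Variable V : set E.
Hypothesis subV : subspace V.

Lemma subspace0 : V 0. Proof. by case: subV. Qed.

Lemma subspaceD x y : V x -> V y -> V (x + y).
Proof. by move=> Vx Vy; rewrite -[x]scale1r; apply: subV.2. Qed.

Lemma subspaceZ a x : V x -> V (a *: x).
Proof. by move=> Vx; rewrite -[_ *: _]addr0; apply: subV.2 => //; exact: subspace0. Qed.

Lemma subspaceN x : V x -> V (- x).
Proof. by rewrite -scaleN1r; exact: subspaceZ. Qed.

Lemma subspaceB x y : V x -> V y -> V (x - y).
Proof. by move=> Vx Vy; apply: subspaceD => //; exact: subspaceN. Qed.

End Subspace.

Section Form.
Variables (L : set E) (B : E -> E -> R).
Hypotheses (subL : subspace L) (siB : semi_inner L B).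
Local Notation q x := (B x x).
Let LD := subspaceD subL.
Let LB := subspaceB subL.
Let LZ := subspaceZ subL.
Let LN := subspaceN subL.

Lemma semi_innerDl x y z : L x -> L y -> L z -> B (x + y) z = B x z + B y z.
Proof. by move=> *; rewrite -{1}[x]scale1r (semi_innerP siB)// mul1r. Qed.

Lemma semi_inner0l z : L z -> B 0 z = 0.
Proof.
move=> Lz; have L0 := subspace0 subL.
by have := semi_innerDl L0 L0 Lz; rewrite addr0 => /eqP; rewrite -subr_eq0 opprD addNKr oppr_eq0 => /eqP.
Qed.

Lemma semi_innerZl a x z : L x -> L z -> B (a *: x) z = a * B x z.
Proof.
move=> Lx Lz; rewrite -[a *: x]addr0 (semi_innerP siB)//; last exact: subspace0.
by rewrite semi_inner0l// addr0.
Qed.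

Lemma semi_innerBl x y z : L x -> L y -> L z -> B (x - y) z = B x z - B y z.
Proof.
move=> Lx Ly Lz; rewrite -scaleN1r addrC (semi_innerP siB)//; lra.
Qed.

Lemma semi_innerBr x y z : L x -> L y -> L z -> B x (y - z) = B x y - B x z.
Proof.
by move=> Lx Ly Lz; rewrite ?(semi_innerC siB Lx) ?semi_innerBl//; exact: LB.
Qed.

Lemma semi_innerDr x y z : L x -> L y -> L z -> B x (y + z) = B x y + B x z.
Proof.
by move=> Lx Ly Lz; rewrite ?(semi_innerC siB Lx) ?semi_innerDl//; exact: LD.
Qed.

Lemma semi_innerZr a x y : L x -> L y -> B x (a *: y) = a * B x y.
Proof.
by move=> Lx Ly; rewrite ?(semi_innerC siB Lx) ?semi_innerZl//; exact: LZ.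
Qed.

Lemma normsqD x y : L x -> L y -> q (x + y) = q x + 2 * B x y + q y.
Proof.
move=> Lx Ly; rewrite semi_innerDl ?semi_innerDr//; try exact: LD.
rewrite (semi_innerC siB Ly Lx); lra.
Qed.

Lemma normsqZ a x : L x -> q (a *: x) = a ^+ 2 * q x.
Proof.
by move=> Lx; rewrite semi_innerZl ?semi_innerZr//; [rewrite mulrA -expr2|exact: LZ].
Qed.

Lemma normsqN x : L x -> q (- x) = q x.
Proof. by move=> Lx; rewrite -scaleN1r normsqZ// sqrrN expr1n mul1r. Qed.

Lemma normsqB x y : L x -> L y -> q (x - y) = q x - 2 * B x y + q y.
Proof.
move=> Lx Ly; rewrite normsqD ?normsqN//; last exact: LN.
by rewrite -scaleN1r semi_innerZr//; lra.
Qed.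

Lemma normsqBC x y : L x -> L y -> q (x - y) = q (y - x).
Proof. by move=> Lx Ly; rewrite -normsqN ?opprB//; exact: LB. Qed.

Lemma normsqD_le x y : L x -> L y -> q (x + y) <= 2 * (q x + q y).
Proof.
move=> Lx Ly; have := semi_inner_ge0 siB (LB Lx Ly).
rewrite normsqB// normsqD//; lra.
Qed.

Lemma normsqB_le x y z : L x -> L y -> L z ->
  q (x - z) <= 2 * (q (x - y) + q (y - z)).
Proof.
move=> Lx Ly Lz.
have -> : x - z = (x - y) + (y - z) by rewrite addrA subrK.
by apply: normsqD_le; exact: LB.
Qed.

Lemma cauchy_schwarz x y : L x -> L y -> B x y ^+ 2 <= q x * q y.
Proof.
move=> Lx Ly.
have qx := semi_inner_ge0 siB Lx; have qy := semi_inner_ge0 siB Ly.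
have P a : 0 <= a ^+ 2 * q x + 2 * (a * B x y) + q y.
  have := semi_inner_ge0 siB (LD (LZ a Lx) Ly).
  by rewrite normsqD ?normsqZ ?semi_innerZl//; exact: LZ.
have [x0|x0] := eqVneq (q x) 0; last first.
  (* the discriminant argument: minimize the quadratic polynomial in a *)
have := P (- (B x y / q x)); rewrite -(pmulr_rge0 _ (_ : 0 < q x)) ?lt_neqAle ?qx ?andbT 1?eq_sym//.
  have -> : q x * ((- (B x y / q x)) ^+ 2 * q x + 2 * (- (B x y / q x) * B x y) + q y) =
     q x * q y - B x y ^+ 2 by field.
  by rewrite subr_ge0.
have [-> |b0] := eqVneq (B x y) 0; first by rewrite expr0n/= mulr_ge0.
(* a null x: a linear polynomial in a is nonnegative only if it is constant *)
have := P (- (q y + 1) / (2 * B x y)).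
rewrite x0.
have -> : - (q y + 1) / (2 * B x y) * B x y = - (q y + 1) / 2 by field.
lra.
Qed.

Lemma converges_normsq_le u x k c : (forall n, L (u n)) -> L x -> L k ->
  converges_for B u x -> (forall e, 0 < e -> exists n0, forall n, (n0 <= n)%N -> q (u n - k) < c + e) ->
  q (x - k) <= c.
Proof.
move=> Lu Lx Lk ux uc; apply/ler_addgt0Pr => e e0.
have qxk := semi_inner_ge0 siB (LB Lx Lk).
pose M := q (x - k) + 1.
have M0 : 0 < M by rewrite /M; lra.
have e1 : 0 < (e / 4) ^+ 2 / M by rewrite divr_gt0// exprn_gt0// divr_gt0.
(* expand q (u n - k) around x - k; the cross term is below e by Cauchy-Schwarz *)
have [n1 h1] := ux _ e1.
have e2 : 0 < e / 4 by lra.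
have [n2 h2] := uc _ e2.
pose n := maxn n1 n2.
have {}h1 := h1 n (leq_maxl _ _); have {}h2 := h2 n (leq_maxr _ _).
have Lux := LB (Lu n) Lx; have Lxk := LB Lx Lk.
have := cauchy_schwarz Lux Lxk.
have E1 : u n - k = (u n - x) + (x - k) by rewrite addrA subrK.
move: h2; rewrite E1 normsqD// => h2 CS.
have qux := semi_inner_ge0 siB Lux.
have : q (u n - x) * q (x - k) <= (e / 4) ^+ 2.
  apply: (@le_trans _ _ ((e / 4) ^+ 2 / M * M)); last by rewrite divfK// gt_eqF.
  by apply: ler_pM => //; [exact: ltW|rewrite /M; lra].
move=> /(le_trans CS).
rewrite -real_normK ?num_real// ler_pXn2r ?nnegrE//; last lra.
by rewrite ler_norml => /andP[]; lra.
Qed.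

(** A minimizing sequence is Cauchy by the parallelogram identity, because the
midpoint of two elements of [C] is again at distance at least the infimum. *)
Lemma nearest_point C k : C `<=` L -> C !=set0 ->
    (forall x y, C x -> C y -> C (2^-1 *: (x + y))) -> complete_for B C -> L k ->
  exists2 c, C c & forall x, C x -> q (c - k) <= q (x - k).
Proof.
move=> CL [c0 Cc0] mid Ccomp Lk.
pose S := [set q (x - k) | x in C].
have S0 : S !=set0 by exists (q (c0 - k)), c0.
have Slb : lbound S 0.
  by move=> _ [x Cx <-]; apply: (semi_inner_ge0 siB); apply: LB => //; exact: CL.
have hS : has_inf S by split=> //; exists 0.
pose d := inf S.
have dle x : C x -> d <= q (x - k).
  by move=> Cx; apply: ge_inf; [exists 0|exists x].
have [u hu] : {u : nat -> E & forall n, C (u n) /\ q (u n - k) < d + n.+1%:R^-1}.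
  apply: (@boolp.choice _ _ (fun n x => C x /\ q (x - k) < d + n.+1%:R^-1)) => n.
  have n0 : 0 < n.+1%:R^-1 :> R by rewrite invr_gt0.
  by have [_ [x Cx <-] xn] := inf_adherent n0 hS; exists x.
have Cu n : C (u n) := (hu n).1.
have Lu n : L (u n) by exact: CL.
have near e : 0 < e -> exists n0, forall n, (n0 <= n)%N -> q (u n - k) < d + e.
  move=> e0; have [n0 n0e] : exists n0 : nat, n0.+1%:R^-1 < e.
    exists (Num.truncn e^-1).
    by rewrite invf_plt ?posrE// truncnS_gt.
  exists n0 => n n0n; apply: (lt_le_trans (hu n).2); rewrite lerD2l.
  apply: le_trans (ltW n0e); rewrite lef_pV2 ?posrE//.
  by rewrite ler_nat ltnS.
have cu : cauchy_for B u.
  move=> e e0; have e4 : 0 < e / 4 by lra.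
  have [n0 h0] := near _ e4.
  exists n0 => m n /h0 hm /h0 hn.
  have LM := mid _ _ (Cu m) (Cu n); have dM := dle _ LM.
  have Lm := LB (Lu m) Lk; have Ln := LB (Lu n) Lk.
  have Emid : 2^-1 *: (u m + u n) - k = 2^-1 *: ((u m - k) + (u n - k)).
    rewrite addrACA -opprD scalerBr; congr (_ - _).
    by rewrite -mulr2n -[k *+ 2]scaler_nat scalerA mulVf ?scale1r// pnatr_eq0.
  have Edif : u m - u n = (u m - k) - (u n - k) by rewrite opprB addrA subrK.
  move: dM; rewrite Emid normsqZ; last exact: LD.
  rewrite Edif normsqB// normsqD// => dM.
  have -> : q (u m - k) - 2 * B (u m - k) (u n - k) + q (u n - k) =
   2 * (q (u m - k) + q (u n - k)) - 4 * (2^-1 ^+ 2 *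
           (q (u m - k) + 2 * B (u m - k) (u n - k) + q (u n - k))) by field.
  lra.
have [c Cc uc] := Ccomp u Cu cu.
exists c => // x Cx; apply: le_trans (dle _ Cx).
by apply: (converges_normsq_le Lu (CL _ Cc) Lk uc).
Qed.

(** Moving from [w] in the direction [v] by -B(w - k, v) / (q v + 1) lowers the
distance to [k] unless B(w - k, v) = 0; the +1 takes care of null vectors. *)
Lemma orthogonal_of_nearest V k w : subspace V -> V `<=` L -> L k -> V w ->
  (forall x, V x -> q (w - k) <= q (x - k)) -> forall v, V v -> B (w - k) v = 0.
Proof.
move=> sV VL Lk Vw wmin v Vv.
have Lv := VL _ Vv; have Lwk := LB (VL _ Vw) Lk.
have qv := semi_inner_ge0 siB Lv.
have P t : 0 <= 2 * (t * B (w - k) v) + t ^+ 2 * q v.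
  have := wmin _ (subspaceD sV (subspaceZ sV t Vv) Vw).
  have -> : t *: v + w - k = (w - k) + t *: v by rewrite -addrA addrC.
  rewrite (normsqD Lwk (LZ t Lv)) normsqZ ?semi_innerZr//.
  lra.
have := P (- B (w - k) v / (q v + 1)).
have q1 : 0 < q v + 1 by lra.
have -> : 2 * (- B (w - k) v / (q v + 1) * B (w - k) v) +
  (- B (w - k) v / (q v + 1)) ^+ 2 * q v = - (B (w - k) v ^+ 2 * ((q v + 2) / (q v + 1) ^+ 2)).
  by field; rewrite gt_eqF.
rewrite oppr_ge0 pmulr_lle0; last by apply: divr_gt0; [lra|exact: exprn_gt0].
move=> h; apply/eqP; rewrite -sqrf_eq0 eq_le h sqr_ge0//.
Qed.

Lemma orthogonal_projection V k : subspace V -> V `<=` L -> complete_for B V -> L k ->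
  exists2 w, V w & forall v, V v -> B (w - k) v = 0.
Proof.
move=> sV VL cV Lk.
have [||w Vw wmin] := @nearest_point V k VL _ _ cV Lk.
- by exists 0; exact: subspace0.
- by move=> x y Vx Vy; apply: subspaceZ => //; exact: subspaceD.
by exists w => //; apply: orthogonal_of_nearest.
Qed.

(** The closure of [V] is complete even if [V] is not, so [k] projects onto it;
the error is orthogonal to [V], hence null. *)
Lemma dense_of_orthogonal V : subspace V -> V `<=` L -> complete_for B L ->
    (forall y, L y -> (forall v, V v -> B y v = 0) -> q y = 0) ->
  dense_for B L V.
Proof.
move=> sV VL cL orth0 k Lk.
pose W := [set x | L x /\ forall e, 0 < e -> exists2 v, V v & q (v - x) < e].
have sW : subspace W.
  split.
    split; first exact: subspace0.
    move=> e e0; exists 0; first exact: subspace0.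
    by rewrite subr0 semi_inner0l//; exact: subspace0.
  move=> a x y [Lx hx] [Ly hy]; split; first exact: subL.2.
  move=> e e0.
  have e1 : 0 < e / (4 * (a ^+ 2 + 1)).
    by rewrite divr_gt0// mulr_gt0//; have := sqr_ge0 a; lra.
  have e2 : 0 < e / 4 by lra.
  have [v Vv vx] := hx _ e1; have [v' Vv' vy] := hy _ e2.
  exists (a *: v + v'); first exact: sV.2.
  have -> : a *: v + v' - (a *: x + y) = a *: (v - x) + (v' - y).
    by rewrite opprD addrACA scalerBr.
  have Lvx := LB (VL _ Vv) Lx; have Lvy := LB (VL _ Vv') Ly.
  apply: le_lt_trans (normsqD_le (LZ a Lvx) Lvy) _.
  rewrite normsqZ//.
  have a1 : 0 < a ^+ 2 + 1 by have := sqr_ge0 a; lra.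
  suff : a ^+ 2 * q (v - x) <= e / 4 by lra.
  apply: (@le_trans _ _ ((a ^+ 2 + 1) * (e / (4 * (a ^+ 2 + 1))))); last first.
    by rewrite le_eqVlt; apply/orP; left; apply/eqP; field; rewrite gt_eqF.
  apply: ler_pM => //; [exact: sqr_ge0|exact: (semi_inner_ge0 siB)|lra|exact: ltW].
have WL : W `<=` L by move=> x [].
have VW v : V v -> W v.
  move=> Vv; split; first exact: VL.
  by move=> e e0; exists v => //; rewrite subrr semi_inner0l//; exact: subspace0.
have cW : complete_for B W.
  move=> u Wu cu; have [x Lx ux] := cL u (fun n => WL _ (Wu n)) cu.
  exists x => //; split => // e e0.
  have e4 : 0 < e / 4 by lra.
  have [n h] := ux _ e4; have {}h := h n (leqnn _).
  have [v Vv vu] := (Wu n).2 _ e4.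
  exists v => //.
  apply: le_lt_trans (normsqB_le (VL _ Vv) (WL _ (Wu n)) Lx) _; lra.
have [w Ww wk] := orthogonal_projection sW WL cW Lk.
have q0 : q (w - k) = 0.
  apply: orth0; first by apply: LB => //; exact: WL.
  by move=> v Vv; apply: wk; exact: VW.
move=> e e0; have e2 : 0 < e / 2 by lra.
have [v Vv vw] := Ww.2 _ e2; exists v => //.
apply: le_lt_trans (normsqB_le (VL _ Vv) (WL _ Ww) Lk) _; lra.
Qed.

End Form.
End SemiInner.

(** * The abstract bounded extremal problem *)

Section BoundedExtremal.
Context {R : realType} {E : lmodType R}.
Variables (L V : set E) (A B : E -> E -> R) (k : E).
Hypotheses (subL : subspace L) (subV : subspace V) (VL : V `<=` L).
Hypotheses (siA : semi_inner L A) (siB : semi_inner L B) (Lk : L k).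
Hypothesis compV : complete_for (fun x y => A x y + B x y) V.
Hypotheses (denseA : dense_for A L V) (denseB : dense_for B L V).

(** The Euler equation of the penalized functional A(g - k) + l B(g - k) over
[V]. *)
Definition normal_eq l g :=
  V g /\ forall v, V v -> A (g - k) v + l * B (g - k) v = 0.

Definition extremal M g := [/\ V g, B (g - k) (g - k) <= M ^+ 2 &
  forall g', V g' -> B (g' - k) (g' - k) <= M ^+ 2 ->
    A (g - k) (g - k) <= A (g' - k) (g' - k)].

Let LB x y : L x -> L y -> L (x - y) := subspaceB subL (x:=x) (y:=y).
Let Vk g : V g -> L (g - k).
Proof. by move=> /VL Lg; exact: LB. Qed.
Let A0 x : L x -> 0 <= A x x. Proof. exact: (semi_inner_ge0 siA). Qed.
Let B0 x : L x -> 0 <= B x x. Proof. exact: (semi_inner_ge0 siB). Qed.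

Lemma semi_inner_combine l : 0 <= l -> semi_inner L (fun x y => A x y + l * B x y).
Proof.
move=> l0; split=> [x y Lx Ly|a x y z Lx Ly Lz|x Lx].
- by rewrite (semi_innerC siA)// (semi_innerC siB).
- by rewrite (semi_innerP siA)// (semi_innerP siB)//; ring.
- by rewrite addr_ge0 ?mulr_ge0 ?A0 ?B0.
Qed.

(** The form A + l B is equivalent to A + B, so completeness of [V] passes to
it. *)
Lemma normal_eq_exists l : 0 < l -> exists g, normal_eq l g.
Proof.
move=> l0.
have compl : complete_for (fun x y => A x y + l * B x y) V.
  have m0 : 0 < Num.min 1 l by rewrite lt_min ltr01.
  have M0 : 0 < Num.max 1 l by rewrite lt_max ltr01.
  move=> u Vu cu; have [|x Vx ux] := compV Vu.
    move=> e e0; have [n0 h] := cu (e * Num.min 1 l) (mulr_gt0 e0 m0).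
    exists n0 => m n hm hn; have := h m n hm hn.
    rewrite -(ltr_pM2r m0 _ e); apply: le_lt_trans.
    have Lmn := LB (VL (Vu m)) (VL (Vu n)); have Amn := A0 Lmn; have Bmn := B0 Lmn.
    rewrite mulrDl lerD//.
      by apply: ler_piMr => //; rewrite ge_min lexx.
    by rewrite mulrC ler_wpM2r// ge_min lexx orbT.
  exists x => // e e0; have [n0 h] := ux (e / Num.max 1 l) (divr_gt0 e0 M0).
  exists n0 => n hn; have := h n hn; rewrite ltr_pdivlMr//; apply: le_lt_trans.
  have Ln := LB (VL (Vu n)) (VL Vx); have An := A0 Ln; have Bn := B0 Ln.
  rewrite mulrDl lerD//.
    by apply: ler_peMr => //; rewrite le_max lexx.
  by rewrite mulrC ler_wpM2l// le_max lexx orbT.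
have [g Vg h] := orthogonal_projection subL (semi_inner_combine (ltW l0)) subV VL compl Lk.
by exists g.
Qed.

Lemma normal_eq_pythagoras l g g' : 0 < l -> normal_eq l g -> V g' ->
  A (g' - k) (g' - k) + l * B (g' - k) (g' - k) =
  (A (g - k) (g - k) + l * B (g - k) (g - k)) +
  (A (g' - g) (g' - g) + l * B (g' - g) (g' - g)).
Proof.
move=> l0 [Vg ng] Vg'.
have -> : g' - k = (g - k) + (g' - g) by rewrite [RHS]addrC addrA subrK.
have Lgk := Vk Vg; have Ld := LB (VL Vg') (VL Vg).
rewrite (normsqD subL siA)// (normsqD subL siB)//.
have := ng _ (subspaceB subV Vg' Vg) => /(congr1 ( *%R 2)).
by rewrite mulr0 => e0; apply/eqP; rewrite -subr_eq0 -[X in _ == X]e0; apply/eqP; ring.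
Qed.

(** Subtract the two equations, both tested against
g - g' = (g - k) - (g' - k), and use the symmetry of the forms. *)
Lemma normal_eq_difference l l' g g' : normal_eq l g -> normal_eq l' g' ->
  2 * A (g - g') (g - g') + (l + l') * B (g - g') (g - g') =
  (l' - l) * (B (g - k) (g - k) - B (g' - k) (g' - k)).
Proof.
move=> [Vg ng] [Vg' ng'].
have Lg := Vk Vg; have Lg' := Vk Vg'.
have -> : g - g' = (g - k) - (g' - k) by rewrite opprB addrA subrK.
have Vd : V ((g - k) - (g' - k)) by rewrite opprB addrA subrK; exact: subspaceB.
have := ng _ Vd; have := ng' _ Vd.
move: (g - k) (g' - k) Lg Lg' => x y Lg Lg'.
rewrite !(normsqB subL siA)// !(normsqB subL siB)//.
rewrite !(semi_innerBr subL siA)// !(semi_innerBr subL siB)//.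
rewrite (semi_innerC siA Lg' Lg) (semi_innerC siB Lg' Lg) => e1 e2.
have e : 2 * ((A x x - A x y + l * (B x x - B x y)) -
             (A x y - A y y + l' * (B x y - B y y))) = 0 by rewrite e1 e2; ring.
by apply/eqP; rewrite -subr_eq0 -[X in _ == X]e; apply/eqP; ring.
Qed.

Local Notation m g := (B (g - k) (g - k)).

Lemma residual_antitone l l' g g' : 0 < l -> l <= l' ->
  normal_eq l g -> normal_eq l' g' -> m g' <= m g.
Proof.
move=> l0; rewrite le_eqVlt => /predU1P[<- | ll'] ng ng'.
  have := normal_eq_difference ng ng'.
  have Ld := LB (VL ng.1) (VL ng'.1); have Lg := Vk ng.1; have Lg' := Vk ng'.1.
  have := cauchy_schwarz subL siB Ld (subspaceD subL Lg Lg').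
  rewrite subrr mul0r => + e; have -> : B (g - g') (g - g') = 0.
    have := A0 Ld; have := B0 Ld; nra.
  rewrite mul0r => h.
  have /eqP : B (g - g') ((g - k) + (g' - k)) ^+ 2 = 0.
    by apply/eqP; rewrite eq_le h sqr_ge0.
  rewrite sqrf_eq0 => /eqP.
  have -> : g - g' = (g - k) - (g' - k) by rewrite opprB addrA subrK.
  move: (g - k) (g' - k) Lg Lg' => x y Lg Lg'.
  rewrite (semi_innerBl siB)//; last exact: subspaceD.
  rewrite !(semi_innerDr subL siB)// (semi_innerC siB Lg' Lg); lra.
have := normal_eq_difference ng ng'.
have Ld := LB (VL ng.1) (VL ng'.1).
have := A0 Ld; have := B0 Ld; nra.
Qed.

(** The difference m(l) - m(l') is B(g - g', (g - k) + (g' - k)).  Its square is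
at most 4 m(l) B(g - g') by Cauchy-Schwarz, and [normal_eq_difference] bounds
2 l B(g - g') by (l' - l) (m(l) - m(l')). *)
Lemma residual_lipschitz l l' g g' : 0 < l -> l <= l' ->
  normal_eq l g -> normal_eq l' g' ->
  m g - m g' <= 2 * (m g / l) * (l' - l).
Proof.
move=> l0 ll' ng ng'.
have anti := residual_antitone l0 ll' ng ng'.
have Lg := Vk ng.1; have Lg' := Vk ng'.1.
have Ld := LB (VL ng.1) (VL ng'.1); have Ad := A0 Ld; have Bd := B0 Ld.
have dif := normal_eq_difference ng ng'.
have CS := cauchy_schwarz subL siB Ld (subspaceD subL Lg Lg').
have sumle := normsqD_le subL siB Lg Lg'.
have mg := B0 Lg; have mg' := B0 Lg'.
have E1 : B (g - g') ((g - k) + (g' - k)) = m g - m g'.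
  have -> : g - g' = (g - k) - (g' - k) by rewrite opprB addrA subrK.
  move: (g - k) (g' - k) Lg Lg' => x y Lg Lg'.
  rewrite (semi_innerBl siB)//; last exact: subspaceD.
  rewrite !(semi_innerDr subL siB)// (semi_innerC siB Lg' Lg); lra.
rewrite E1 in CS.
set D := m g - m g' in CS dif *.
have D0 : 0 <= D by rewrite subr_ge0.
have [->|Dn0] := eqVneq D 0.
  by rewrite mulr_ge0 ?subr_ge0// mulr_ge0// divr_ge0// ltW.
have Dp : 0 < D by rewrite lt_neqAle eq_sym Dn0.
have S4 : B (g - k + (g' - k)) (g - k + (g' - k)) <= 4 * m g by lra.
have lB : 2 * l * B (g - g') (g - g') <= (l' - l) * D.
  rewrite -dif; have : 0 <= (l' - l) * B (g - g') (g - g').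
    by rewrite mulr_ge0// subr_ge0.
  nra.
have DD : D ^+ 2 <= B (g - g') (g - g') * (4 * m g).
  by apply: le_trans CS _; rewrite ler_wpM2l.
have : l * D ^+ 2 <= 2 * m g * (l' - l) * D.
  apply: (@le_trans _ _ (l * (B (g - g') (g - g') * (4 * m g)))).
    by rewrite ler_wpM2l// ltW.
  have -> : l * (B (g - g') (g - g') * (4 * m g)) =
    (2 * m g) * (2 * l * B (g - g') (g - g')) by ring.
  have -> : 2 * m g * (l' - l) * D = (2 * m g) * ((l' - l) * D) by ring.
  by rewrite ler_wpM2l// mulr_ge0.
rewrite expr2 [l * (D * D)]mulrA (ler_pM2r Dp) => h.
have -> : 2 * (m g / l) * (l' - l) = 2 * m g * (l' - l) / l by field; rewrite gt_eqF.
by rewrite ler_pdivlMr// mulrC.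
Qed.

(** Equal residuals force g = g' up to null vectors; then the two equations
differ by a multiple of B(g - k, v) = 0, and density of [V] concludes. *)
Lemma residual_injective l l' g g' : 0 < l -> 0 < l' -> l != l' ->
  normal_eq l g -> normal_eq l' g' -> m g = m g' -> m g = 0.
Proof.
move=> l0 l'0 ll' ng ng' mm.
have Lg := Vk ng.1; have Lg' := Vk ng'.1.
have Ld := LB (VL ng.1) (VL ng'.1); have Ad := A0 Ld; have Bd := B0 Ld.
have := normal_eq_difference ng ng'; rewrite mm subrr mulr0 => dif.
have Ad0 : A (g - g') (g - g') = 0 by nra.
have Bd0 : B (g - g') (g - g') = 0 by nra.
have null (F : E -> E -> R) v : semi_inner L F -> F (g - g') (g - g') = 0 -> V v ->
    F (g - k) v = F (g' - k) v.
  move=> siF F0 /VL Lv; have := cauchy_schwarz subL siF Ld Lv.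
  rewrite F0 mul0r => h.
  have /eqP : F (g - g') v ^+ 2 = 0 by apply/eqP; rewrite eq_le h sqr_ge0.
  rewrite sqrf_eq0 => /eqP.
  have -> : g - g' = (g - k) - (g' - k) by rewrite opprB addrA subrK.
  by rewrite (semi_innerBl siF)// => /eqP; rewrite subr_eq0 => /eqP.
have orth v : V v -> B (g' - k) v = 0.
  move=> Vv; have := ng.2 _ Vv; have := ng'.2 _ Vv.
  rewrite (null _ _ siA Ad0 Vv) (null _ _ siB Bd0 Vv) => e1 e2.
  have /eqP : (l - l') * B (g' - k) v = 0 by rewrite mulrBl; lra.
  by rewrite mulf_eq0 subr_eq0 (negbTE ll') => /eqP.
apply/eqP; rewrite eq_le B0// andbT.
apply/ler_addgt0Pr => e e0; rewrite add0r.
have [v Vv ve] := denseB Lg' e0.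
have Lv := VL Vv; have Lw := LB Lv Lg'.
move: ve; rewrite (normsqB subL siB)// (semi_innerC siB)// orth//.
have := B0 Lv; lra.
Qed.

Lemma normal_eq_le l g v : 0 < l -> normal_eq l g -> V v ->
  A (g - k) (g - k) + l * m g <= A (v - k) (v - k) + l * m v.
Proof.
move=> l0 ng Vv; rewrite (normal_eq_pythagoras l0 ng Vv) lerDl.
have Ld := LB (VL Vv) (VL ng.1).
by rewrite addr_ge0 ?mulr_ge0 ?A0 ?B0// ltW.
Qed.

Lemma residual_small e : 0 < e -> exists2 l, 0 < l &
  forall g, normal_eq l g -> m g < e.
Proof.
move=> e0; have e2 : 0 < e / 2 by lra.
have [v Vv ve] := denseB Lk e2.
have Av := A0 (Vk Vv).
pose l := (A (v - k) (v - k) + 1) / (e / 2).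
have l0 : 0 < l by apply: divr_gt0 => //; lra.
exists l => // g ng.
have := normal_eq_le l0 ng Vv => h.
have Ag := A0 (Vk ng.1).
have : l * m g < l * e.
  have le2 : l * (e / 2) = A (v - k) (v - k) + 1 by rewrite /l divfK// gt_eqF.
  have : l * m v < l * (e / 2) by rewrite ltr_pM2l.
  have -> : l * e = l * (e / 2) + l * (e / 2) by field.
  lra.
by rewrite ltr_pM2l.
Qed.

(** Along l = 1 / (n + 1) a bounded residual converges, being monotone, and
[normal_eq_difference] controls the solutions by its increments: they
converge, to an element of [V] that equals [k] for the form A. *)
Lemma residual_unbounded M : ~ (exists2 v, V v & A (v - k) (v - k) = 0) ->
  exists2 l, 0 < l & forall g, normal_eq l g -> M < m g.
Proof.
move=> hk; apply: contrapT => hM.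
have bound l g : 0 < l -> normal_eq l g -> m g <= M.
  move=> l0 ng; rewrite leNgt; apply/negP => Mg; apply: hM; exists l => // g' ng'.
  by apply: lt_le_trans Mg (residual_antitone l0 (lexx l) ng' ng).
pose s n : R := n.+1%:R^-1.
have s0 n : 0 < s n by rewrite invr_gt0.
have [u nu] : {u : nat -> E & forall n, normal_eq (s n) (u n)}.
  by apply: (@boolp.choice _ _ (fun n => normal_eq (s n))) => n; exact: normal_eq_exists.
have Vu n : V (u n) := (nu n).1.
pose mm n := m (u n).
have mmM n : mm n <= M by exact: bound (nu n).
have incr i j : (i <= j)%N -> mm i <= mm j.
  move=> ij; apply: (residual_antitone (s0 j) _ (nu j) (nu i)).
  by rewrite lef_pV2 ?posrE// ler_nat.
pose S := range mm.
have hS : has_sup S by split; [exists (mm 0%N), 0%N|exists M => _ [n _ <-]].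
pose d := sup S.
have lesup n : mm n <= d by apply: ub_le_sup; [exact: hS.2|exists n].
have near e : 0 < e -> exists n0, forall n, (n0 <= n)%N -> d - e < mm n.
  move=> e0; have [_ [n0 _ <-] h] := sup_adherent e0 hS.
  by exists n0 => n /incr; exact: lt_le_trans.
have cu : cauchy_for (fun x y => A x y + B x y) u.
  have wl i j : (i <= j)%N ->
      A (u i - u j) (u i - u j) + B (u i - u j) (u i - u j) <= 2 * (mm j - mm i).
    move=> ij; have := normal_eq_difference (nu i) (nu j).
    have Ld := LB (VL (Vu i)) (VL (Vu j)); have Ad := A0 Ld; have Bd := B0 Ld.
    have := incr _ _ ij; rewrite -/(mm i) -/(mm j).
    have ss : s j <= s i by rewrite lef_pV2 ?posrE// ler_nat.
    have s1 : s i <= 1 by rewrite invf_le1 ?ler1n.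
    have := s0 i; have := s0 j.
    set a := A _ _ in Ad *; set b := B _ _ in Bd *.
    move: (mm i) (mm j) (s i) (s j) ss s1 => mi mj si sj ss s1 sj0 si0 mij dif.
    have D0 : 0 <= mj - mi by lra.
    have h1 : 2 * a <= mj - mi.
      have : 0 <= (si + sj) * b by rewrite mulr_ge0//; lra.
      have : (si - sj) * (mj - mi) <= 1 * (mj - mi) by apply: ler_wpM2r => //; lra.
      lra.
    have h2 : b <= mj - mi.
      have : (si + sj) * b <= (si + sj) * (mj - mi).
        apply: (@le_trans _ _ ((si - sj) * (mj - mi))); first lra.
        by apply: ler_wpM2r => //; lra.
      by rewrite ler_pM2l//; lra.
    lra.
  move=> e e0; have e2 : 0 < e / 2 by lra.
  have [n0 h] := near _ e2; exists n0 => i j hi hj.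
  have [ij|/ltnW ji] := leqP i j.
    by apply: le_lt_trans (wl _ _ ij) _; have := h _ hi; have := lesup j; lra.
  rewrite (normsqBC subL siA (VL (Vu i)) (VL (Vu j))).
  rewrite (normsqBC subL siB (VL (Vu i)) (VL (Vu j))).
  by apply: le_lt_trans (wl _ _ ji) _; have := h _ hj; have := lesup i; lra.
have [x Vx ux] := compV Vu cu.
apply: hk; exists x => //; apply/eqP; rewrite eq_le A0 ?andbT; last exact: Vk.
apply: (@converges_normsq_le _ _ _ _ subL siA u) => //.
- by move=> n; exact: VL.
- exact: VL.
- move=> e /ux[n0 h]; exists n0 => n /h; apply: le_lt_trans.
  by rewrite lerDl B0//; apply: LB; apply: VL.
move=> e e0; have e2 : 0 < e / 2 by lra.
have [v Vv ve] := denseA Lk e2.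
have Bv := B0 (Vk Vv).
(* with v near k for A, minimality of u n bounds A (u n - k) by
   A (v - k) + s n * B (v - k), and s n tends to 0 *)
have [n0 n0e] : exists n0 : nat, s n0 < (e / 2) / (m v + 1).
  exists (Num.truncn ((e / 2) / (m v + 1))^-1).
  by rewrite invf_plt ?posrE ?truncnS_gt// divr_gt0//; lra.
exists n0 => n n0n; rewrite add0r.
have := normal_eq_le (s0 n) (nu n) Vv.
have : 0 <= s n * m (u n) by rewrite mulr_ge0 ?B0//; [exact: ltW|exact: Vk].
have : s n * m v <= e / 2.
  apply: (@le_trans _ _ (s n0 * (m v + 1))).
    apply: ler_pM => //; [exact: ltW| |lra].
    by rewrite lef_pV2 ?posrE// ler_nat ltnS.
  move: n0e; rewrite ltr_pdivlMr; [exact: ltW|lra].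
lra.
Qed.

Lemma normal_eq_extremal l M g : 0 < l -> normal_eq l g -> m g = M ^+ 2 -> extremal M g.
Proof.
move=> l0 ng mg; split=> [||g' Vg' mg']; [exact: ng.1|by rewrite mg|].
have := normal_eq_le l0 ng Vg'.
have : l * m g' <= l * m g by rewrite ler_pM2l// mg.
lra.
Qed.

Lemma extremal_unique l M g g' : 0 < l -> normal_eq l g -> m g = M ^+ 2 -> extremal M g' ->
  A (g' - g) (g' - g) = 0 /\ B (g' - g) (g' - g) = 0.
Proof.
move=> l0 ng mg [Vg' mg' Amin].
have := normal_eq_pythagoras l0 ng Vg'.
have := Amin _ ng.1; rewrite mg lexx => /(_ isT).
have : l * m g' <= l * M ^+ 2 by rewrite ler_pM2l.
have Ld := LB (VL Vg') (VL ng.1); have := A0 Ld; have := B0 Ld => Bd Ad.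
have : 0 <= l * B (g' - g) (g' - g) by rewrite mulr_ge0// ltW.
move=> lB h1 h2 h3; split; first lra.
have /eqP : l * B (g' - g) (g' - g) = 0 by lra.
by rewrite mulf_eq0 gt_eqF//= => /eqP.
Qed.

(** The intermediate value theorem, applied to the residual as a function of
l, with l replaced by max a l to obtain a function that is Lipschitz on the
whole line. *)
Lemma normal_eq_saturates M : 0 < M -> ~ (exists2 v, V v & A (v - k) (v - k) = 0) ->
  exists2 l, 0 < l & forall g, normal_eq l g -> m g = M ^+ 2.
Proof.
move=> M0 hk.
have MM : 0 < M ^+ 2 by rewrite exprn_gt0.
have [a a0 ha] := residual_unbounded (M ^+ 2) hk.
have [b b0 hb] := residual_small MM.
have [G hG] : {G : R -> E & forall l, 0 < l -> normal_eq l (G l)}.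
  apply: (@boolp.choice _ _ (fun l g => 0 < l -> normal_eq l g)) => l.
  have [l0|] := pselect (0 < l); first by have [g ng] := normal_eq_exists l0; exists g.
  by move=> nl0; exists 0.
have ab : a < b.
  rewrite ltNge; apply/negP => ba.
  have := residual_antitone b0 ba (hG _ b0) (hG _ a0).
  have := ha _ (hG _ a0); have := hb _ (hG _ b0); lra.
have aM x : a <= Num.max a x by rewrite le_max lexx.
pose f l := m (G (Num.max a l)).
have nf l : normal_eq (Num.max a l) (G (Num.max a l)).
  by apply: hG; apply: lt_le_trans a0 (aM l).
have fa0 : 0 <= m (G a) by apply: B0; apply: Vk; exact: (hG _ a0).1.
pose K := 2 * (m (G a) / a).
have K0 : 0 <= K by rewrite mulr_ge0// divr_ge0// ltW.
have lip x y : x <= y -> `|f x - f y| <= K * `|x - y|.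
  move=> xy; have xy' : Num.max a x <= Num.max a y.
    by rewrite ge_max aM/= le_max xy orbT.
  have x0 : 0 < Num.max a x by exact: lt_le_trans a0 (aM x).
  have anti := residual_antitone x0 xy' (nf x) (nf y).
  rewrite ger0_norm ?subr_ge0//.
  apply: le_trans (residual_lipschitz x0 xy' (nf x) (nf y)) _.
  apply: ler_pM; rewrite ?subr_ge0//.
  - by rewrite mulr_ge0// divr_ge0 ?(ltW x0)// B0//; apply: Vk; exact: (nf x).1.
  - rewrite ler_pM2l//; apply: ler_pM.
    + by apply: B0; apply: Vk; exact: (nf x).1.
    + by rewrite invr_ge0 ltW.
    + exact: residual_antitone a0 (aM x) (hG _ a0) (nf x).
    + by rewrite lef_pV2 ?posrE.
  - rewrite distrC ger0_norm ?subr_ge0// /Num.max; case: ltP => ?; case: ltP => ?; lra.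
have cf : {within `[a, b], continuous f}.
  apply: continuous_subspaceT => x; apply/cvgrPdist_le => e e0.
  near=> y; apply: (@le_trans _ _ ((K + 1) * `|x - y|)).
    apply: (@le_trans _ _ (K * `|x - y|)); last by apply: ler_wpM2r => //; lra.
    have [xy|/ltW yx] := leP x y; first exact: lip.
    by rewrite distrC (distrC x); exact: lip.
  rewrite mulrC -ler_pdivlMr; last lra.
  near: y; apply: cvgr_dist_le => //; apply: divr_gt0 => //; lra.
have [|c] := IVT (ltW ab) cf (v := M ^+ 2).
  have := ha _ (hG _ a0); have := hb _ (hG _ b0); rewrite /f (max_idPl (lexx a)) (max_idPr (ltW ab)) => h1 h2.
  by rewrite ge_min le_max (ltW h1) (ltW h2) orbT.
rewrite in_itv/= => /andP[ac cb] fc.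
have c0 : 0 < c by lra.
exists c => // g ng; apply/eqP; rewrite -fc /f (max_idPr ac) eq_le.
by rewrite !(residual_antitone c0 (lexx c))//; exact: hG.
Unshelve. all: by end_near. Qed.

End BoundedExtremal.

(** * Lebesgue measure on the angles *)

Section RealIntegrable.
Context d (T : measurableType d) (R : realType) (mu : {measure set T -> \bar R}).
Variables (D : set T) (mD : measurable D).
Implicit Types f g : T -> R.

Lemma integrable_scale a f : mu.-integrable D (EFin \o f) ->
  mu.-integrable D (EFin \o (fun t => a * f t)).
Proof. exact: (@integrableZl _ _ _ mu D mD a (EFin \o f)). Qed.

Lemma integrable_add f g : mu.-integrable D (EFin \o f) ->
  mu.-integrable D (EFin \o g) -> mu.-integrable D (EFin \o (fun t => f t + g t)).
Proof. exact: (@integrableD _ _ _ mu D mD (EFin \o f) (EFin \o g)). Qed.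

End RealIntegrable.

Section AngleMeasure.
Context {R : realType}.
Local Notation lambda := (@completed_lebesgue_measure R).
Local Notation LR := (lebesgueType R).

Lemma borel_lebesgue (A : set R) : measurable A -> measurable (A : set LR).
Proof. exact: sub_caratheodory. Qed.

(** Integrals over Lebesgue sets thus reduce to integrals over Borel sets,
where induction on the generators is available. *)
Lemma lebesgue_borel_negligible (A : set LR) : measurable A ->
  exists B N : set R, [/\ measurable B, lambda.-negligible N & A = B `|` N].
Proof.
move=> mA; have : (completed_algebra_gen (@lebesgue_measure R)).-sigma.-measurable A.
  by rewrite completed_caratheodory_measurable.
rewrite g_sigma_completed_algebra_genE => -[B mB [N [C [mC C0 NC]] <-]].
exists B, N; split => //; exists C; split => //; exact: borel_lebesgue.
Qed.

Lemma continuous_lebesgue_measurable (f : R -> R) (A : set LR) :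
  continuous f -> measurable_fun A f.
Proof.
move=> cf; apply: (measurable_funS (E := setT)) => //.
move=> _ Y mY; have := continuous_measurable_fun cf measurableT mY.
exact: borel_lebesgue.
Qed.

Lemma angles_circle : angles circle = `[0, 2 * pi[%classic :> set R.
Proof.
apply/seteqP; split => t /=; rewrite in_itv/=; first by case.
move=> t2; split => //; rewrite /circle/= /expi.
by rewrite normc_def/= cos2Dsin2 sqrtr1.
Qed.

Lemma measurable_angles_circle : measurable (angles circle : set LR).
Proof. by rewrite angles_circle; exact: borel_lebesgue. Qed.

Lemma lambda_circle_lty : (lambda (angles circle) < +oo)%E.
Proof.
rewrite angles_circle [ltLHS](_ : _ = lebesgue_measure `[0, 2 * (pi : R)[%classic)//.
by rewrite lebesgue_measure_itv/=; case: ifP => // _; rewrite -EFinB ltry.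
Qed.

Lemma lambda_set1 (t : R) : lambda [set t] = 0%E.
Proof. by rewrite [LHS](_ : _ = lebesgue_measure [set t])// lebesgue_measure_set1. Qed.

End AngleMeasure.

(** * Completeness of real L2 *)

Section SquareIntegrable.
Context d (T : measurableType d) (R : realType) (mu : {measure set T -> \bar R}).
Variables (D : set T) (mD : measurable D).
Implicit Types f g : T -> R.

Definition square_integrable f :=
  measurable_fun D f /\ mu.-integrable D (EFin \o (fun t => f t ^+ 2)).

Lemma square_integrableM f g : square_integrable f -> square_integrable g ->
  mu.-integrable D (EFin \o (fun t => f t * g t)).
Proof.
move=> [mf if2] [mg ig2].
have i := integrable_add mD if2 ig2.
apply: (le_integrable mD _ _ i).
  by apply/measurable_EFinP; exact: measurable_funM.
move=> t _ /=; rewrite lee_fin (ger0_norm (addr_ge0 (sqr_ge0 _) (sqr_ge0 _))).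
rewrite normrM -(real_normK (num_real (f t))) -(real_normK (num_real (g t))).
have := sqr_ge0 (`|f t| - `|g t|).
have : 0 <= `|f t| * `|g t| by rewrite mulr_ge0.
by nra.
Qed.

Lemma square_integrableP a f g : square_integrable f -> square_integrable g ->
  square_integrable (fun t => a * f t + g t).
Proof.
move=> Lf Lg; have [mf if2] := Lf; have [mg ig2] := Lg.
split; first by apply: measurable_funD => //; exact: measurable_funM.
have -> : (fun t => (a * f t + g t) ^+ 2) = (fun t => a ^+ 2 * f t ^+ 2 +
    (2 * a * (f t * g t) + g t ^+ 2)) by apply/funext => t; ring.
apply: integrable_add => //; first exact: integrable_scale.
apply: integrable_add => //; apply: integrable_scale => //.
exact: square_integrableM.
Qed.

Lemma square_integrableB f g : square_integrable f -> square_integrable g ->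
  square_integrable (fun t => f t - g t).
Proof.
move=> Lf Lg; have := square_integrableP (-1) Lg Lf.
by congr square_integrable; apply/funext => t; ring.
Qed.

Lemma integral_square_EFin f : square_integrable f ->
  (\int[mu]_(t in D) (f t ^+ 2)%:E = (\int[mu]_(t in D) (f t ^+ 2))%:E)%E.
Proof. by move=> [_ i]; rewrite /Rintegral fineK//; exact: integrable_fin_num. Qed.

Variable u : nat -> T -> R.
Hypothesis Lu : forall n, square_integrable (u n).
Hypothesis cauchy_u : forall e, 0 < e -> exists n0, forall m n, (n0 <= m)%N -> (n0 <= n)%N ->
  \int[mu]_(t in D) ((u m t - u n t) ^+ 2) < e.

Let fast (k : nat) : R := (4 ^+ k)^-1 / (2 ^ k.+1)%:R.
Let fast_gt0 k : 0 < fast k.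
Proof. by rewrite divr_gt0 ?invr_gt0 ?exprn_gt0// ltr0n expn_gt0. Qed.

Lemma fast_subsequence : exists s : nat -> nat,
  [/\ {homo s : i j / (i <= j)%N}, forall k, (k <= s k)%N & forall k m n, (s k <= m)%N -> (s k <= n)%N -> \int[mu]_(t in D) ((u m t - u n t) ^+ 2) < fast k].
Proof.
have [N hN] : {N : nat -> nat & forall k, forall m n, (N k <= m)%N -> (N k <= n)%N ->
    \int[mu]_(t in D) ((u m t - u n t) ^+ 2) < fast k}.
  apply: (@boolp.choice _ _ (fun k N => forall m n, (N <= m)%N -> (N <= n)%N ->
    \int[mu]_(t in D) ((u m t - u n t) ^+ 2) < fast k)) => k.
  exact: cauchy_u (fast_gt0 k).
pose s k := (k + \sum_(j < k.+1) N j)%N.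
have Ns k : (N k <= s k)%N by rewrite /s big_ord_recr/= addnA leq_addl.
exists s; split => [|k|k m n km kn].
- apply: homo_leq => [//|j i l|k]; first exact: leq_trans.
  by rewrite /s leq_add// [leqRHS]big_ord_recr/= leq_addr.
- exact: leq_addr.
by apply: hN; [exact: leq_trans km|exact: leq_trans kn].
Qed.

(** Along a subsequence whose k-th increment has squared norm below
4^-k 2^-(k+1), the sum of the 4^k |increment|^2 has finite integral; where it
is finite the increments are dominated by a geometric series. *)
Lemma square_integrable_ae_limit : exists (s : nat -> nat) (v : T -> R),
  [/\ {homo s : i j / (i <= j)%N}, forall k, (k <= s k)%N, measurable_fun D v &
    {ae mu, forall t, D t -> u (s k) t @[k --> \oo] --> v t}].
Proof.
have [s [hs ks fs]] := fast_subsequence.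
pose w k := u (s k); pose dw k t := w k.+1 t - w k t.
have Lw k : square_integrable (dw k) by apply: square_integrableB; exact: Lu.
pose S t : \bar R := (\sum_(k <oo) (4 ^+ k * dw k t ^+ 2)%:E)%E.
have mterm k : measurable_fun D (fun t => (4 ^+ k * dw k t ^+ 2)%:E).
  apply/measurable_EFinP; apply: measurable_funM => //.
  by apply: measurable_funX; exact: (Lw k).1.
have term0 k t : (0 <= (4 ^+ k * dw k t ^+ 2)%:E)%E.
  by rewrite lee_fin; apply: mulr_ge0; [exact: exprn_ge0|exact: sqr_ge0].
have mS : measurable_fun D S.
  by apply: (@ge0_emeasurable_sum _ _ _ D (fun k t => (4 ^+ k * dw k t ^+ 2)%:E) xpredT) => k * //=; exact: term0.
have iS : mu.-integrable D S.
  apply/integrableP; split => //.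
  have S0 t : (0 <= S t)%E by apply: nneseries_ge0 => k _ _; exact: term0.
  rewrite (eq_integral S) => [|t _]; last by rewrite gee0_abs.
  rewrite integral_nneseries//.
  apply: (@le_lt_trans _ _ 1%:E); last exact: ltry.
  apply: le_trans (epsilon_trick0 xpredT (ler01 : 0 <= (1 : R))).
  apply: lee_nneseries => // [k _ _|k _]; first exact: integral_ge0.
  under eq_integral do rewrite EFinM.
  have [md id2] := Lw k.
  rewrite integralZl// integral_square_EFin// -EFinM lee_fin.
  rewrite -ler_pdivlMl ?exprn_gt0// mul1r; apply/ltW/fs => //.
  exact: hs.
(* v is the limit of the subsequence on E, and an arbitrary constant off E,
   which makes it measurable *)
pose E := D `&` [set t | (S t < +oo)%E].
have mE : measurable E by exact: emeasurable_fun_infty_o.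
have Econv t : E t -> cvgn (w ^~ t).
  move=> [Dt St].
  have S0 : (0 <= S t)%E by exact: nneseries_ge0.
  have Sfin : S t \is a fin_num by rewrite ge0_fin_numE.
  pose C := fine (S t) + 1.
  have C1 : 1 <= C by rewrite lerDr fine_ge0.
  have dC k : `|dw k t| <= geometric C 2^-1 k.
    have : ((4 ^+ k * dw k t ^+ 2)%:E <= S t)%E.
      apply: le_trans (nneseries_lim_ge k.+1 _) => //.
      by rewrite big_nat_recr//= leeDr// sume_ge0.
    rewrite -(fineK Sfin) lee_fin => h.
    rewrite /geometric/= -(@ler_pXn2r _ 2) ?nnegrE//; last first.
      by rewrite mulr_ge0 ?exprn_ge0//; lra.
    rewrite real_normK ?num_real// exprMn exprAC (_ : 2^-1 ^+ 2 = 4^-1); last by field.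
    rewrite exprVn ler_pdivlMr ?exprn_gt0// mulrC; apply: le_trans h _.
    have : 0 <= fine (S t) by exact: fine_ge0.
    by rewrite /C; nra.
  have : cvgn (series (fun k => dw k t)).
    apply: normed_cvg; apply: series_le_cvg dC _ => //.
      by move=> k; rewrite /geometric/= mulr_ge0 ?exprn_ge0//; lra.
    by apply: is_cvg_geometric_series; rewrite ger0_norm; lra.
  move=> c; have -> : w ^~ t = fun n => series (fun k => dw k t) n + w 0%N t.
    by apply/funext => n; rewrite (telescopeK (w ^~ t))/= subrK.
  by apply: is_cvgD => //; exact: is_cvg_cst.
pose v t := limn (fun k => (w k \_ E) t).
have Ev t : E t -> w k t @[k --> \oo] --> v t.
  move=> Et; have -> : v t = limn (w ^~ t).
    by rewrite /v; congr (limn _); apply/funext => k; rewrite patchT ?inE.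
  exact: Econv.
exists s, v; split => //.
  apply: (@measurable_fun_cvg _ _ _ D (fun k => w k \_ E)) => [k|t Dt].
    have [h _] := @measurable_restrict _ _ _ _ E D (w k) mE mD; apply: h.
    by apply: measurable_funS (Lu (s k)).1 => // x [].
  have [Et|nE] := pselect (E t).
    rewrite (_ : (fun k => (w k \_ E) t) = w ^~ t); first exact: Ev.
    by apply/funext => k; rewrite patchT ?inE.
  have -> : v t = limn (fun k : nat => point : R).
    by rewrite /v; congr (limn _); apply/funext => k; rewrite patchC ?inE.
  rewrite lim_cst//; rewrite (_ : (fun k => (w k \_ E) t) = fun=> point); first exact: cvg_cst.
  by apply/funext => k; rewrite patchC ?inE.
apply: filterS (integrable_ae mD iS) => t Sfin Dt; apply: Ev; split => //=.
by rewrite -ge0_fin_numE ?Sfin// nneseries_ge0.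
Qed.

(** Fatou's lemma along the almost everywhere convergent subsequence. *)
Lemma square_integrable_complete : exists2 v, square_integrable v &
  forall e, 0 < e -> exists n0, forall n, (n0 <= n)%N ->
    \int[mu]_(t in D) ((u n t - v t) ^+ 2) < e.
Proof.
have [s [v [hs ks mv aev]]] := square_integrable_ae_limit.
have bound n e : (forall m, (n <= m)%N -> \int[mu]_(t in D) ((u m t - u n t) ^+ 2) <= e) ->
    (\int[mu]_(t in D) ((v t - u n t) ^+ 2)%:E <= e%:E)%E.
  move=> he.
  pose F k t := ((u (s (n + k)%N) t - u n t) ^+ 2)%:E.
  have mF k : measurable_fun D (F k).
    have [m _] := square_integrableB (Lu (s (n + k)%N)) (Lu n).
    by apply/measurable_EFinP; exact: measurable_funX.
  have F0 k t : D t -> (0 <= F k t)%E by move=> _; rewrite lee_fin sqr_ge0.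
  have := fatou mu mD mF F0.
  have -> : (\int[mu]_(x in D) limn_einf (F ^~ x) = \int[mu]_(t in D) ((v t - u n t) ^+ 2)%:E)%E.
    apply: ae_eq_integral => //.
    - apply: (measurableT_comp (f := -%E)) => //.
      by apply: measurable_fun_limn_esup => k; exact: measurableT_comp.
    - by apply/measurable_EFinP; apply: measurable_funX; apply: measurable_funB => //; exact: (Lu n).1.
    apply: filterS aev => t vt Dt.
    suff : F ^~ t @ \oo --> ((v t - u n t) ^+ 2)%:E by move=> /cvg_limn_einf_sup[->].
    suff h : (fun k => (u (s (n + k)%N) t - u n t) ^+ 2) @ \oo --> (v t - u n t) ^+ 2.
      by apply: cvg_EFin; [exact: nearW|exact: h].
    have vt' : u (s (n + k)%N) t @[k --> \oo] --> v t.
      have := vt Dt; rewrite -(cvg_shiftn n); apply: cvg_trans.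
      by under eq_fun do rewrite addnC.
    rewrite expr2; under eq_fun do rewrite expr2.
    by apply: cvgM; apply: cvgB => //; exact: cvg_cst.
  move=> /le_trans; apply.
  rewrite limn_einf_lim; apply: lime_le; first exact: is_cvg_einfs.
  apply: nearW => k; apply: (@le_trans _ _ (\int[mu]_(x in D) F k x)%E).
    by apply: ereal_inf_lbound; exists k => /=.
  rewrite /F integral_square_EFin ?lee_fin; last exact: square_integrableB.
  by apply: he; apply: leq_trans (ks _); exact: leq_addr.
have [n1 h1] := cauchy_u ltr01.
have Lv : square_integrable v.
  have Lvu : square_integrable (fun t => v t - u n1 t).
    have m1 : measurable_fun D (fun t => v t - u n1 t).
      by apply: measurable_funB => //; exact: (Lu n1).1.
    split => //; apply/integrableP; split.
      by apply/measurable_EFinP; exact: measurable_funX.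
    under eq_integral do rewrite /= ger0_norm ?sqr_ge0//.
    apply: (@le_lt_trans _ _ 1%:E); last exact: ltry.
    by apply: bound => m n1m; apply/ltW/h1.
  have := square_integrableP 1 Lvu (Lu n1).
  by congr square_integrable; apply/funext => t; ring.
exists v => // e e0; have e2 : 0 < e / 2 by lra.
have [n0 h0] := cauchy_u e2; exists n0 => n n0n.
have Lvu := square_integrableB Lv (Lu n).
apply: (@le_lt_trans _ _ (e / 2)); last lra.
under eq_Rintegral do rewrite -sqrrN opprB.
rewrite -lee_fin -integral_square_EFin//.
apply: bound => m nm; apply/ltW/h0 => //; exact: leq_trans nm.
Qed.

End SquareIntegrable.

(** * Uniqueness for trigonometric moments *)

Section StepPolynomial.
Context {R : realType}.
Implicit Types x y : R.

Lemma bernoulli_le n y : -1 <= y -> 1 + n%:R * y <= (1 + y) ^+ n.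
Proof.
move=> y1; elim: n => [|n IH]; first by rewrite mul0r addr0 expr0.
rewrite exprS; apply: (@le_trans _ _ ((1 + y) * (1 + n%:R * y))).
  rewrite -natr1; have : 0 <= n%:R * y ^+ 2 by rewrite mulr_ge0 ?sqr_ge0.
  nra.
by apply: ler_wpM2l => //; lra.
Qed.

(** Polynomials converging boundedly on [0, 1] to the indicator of [0, 1/2[; they
come from the Brosowski-Deutsch proof of the Stone-Weierstrass theorem. *)
Definition step_poly n x := (1 - x ^+ n) ^+ (2 ^ n).

Lemma step_poly_itv n x : 0 <= x <= 1 -> 0 <= step_poly n x <= 1.
Proof.
move=> /andP[x0 x1]; have xn0 := exprn_ge0 n x0; have xn1 : x ^+ n <= 1 by rewrite exprn_ile1.
by rewrite exprn_ge0 ?exprn_ile1 ?subr_ge0// gerBl.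
Qed.

Lemma step_poly_cvg1 x : 0 <= x < 2^-1 -> step_poly n x @[n --> \oo] --> (1 : R).
Proof.
move=> /andP[x0 x1].
have x01 : 0 <= x <= 1 by rewrite x0/=; lra.
apply: (@squeeze_cvgr _ _ _ _ (fun n => 1 - (2 * x) ^+ n) (fun=> 1)).
- apply: nearW => n; have /andP[_ ->] := step_poly_itv n x01; rewrite andbT.
  have xn1 : x ^+ n <= 1 by rewrite exprn_ile1//; lra.
  have : -1 <= - x ^+ n by lra.
  move=> /(bernoulli_le (2 ^ n)); rewrite mulrN natrX -exprMn.
  by [].
- rewrite -[X in _ --> X]subr0; apply: cvgB; first exact: cvg_cst.
  by apply: cvg_expr; rewrite ger0_norm; lra.
- exact: cvg_cst.
Qed.

(** Multiply by 1 + 2^n x^n <= (1 + x^n)^(2^n) and use that 1 - x^(2 n) <= 1. *)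
Lemma step_poly_cvg0 x : 2^-1 < x <= 1 -> step_poly n x @[n --> \oo] --> (0 : R).
Proof.
move=> /andP[x0 x1].
have x01 : 0 <= x <= 1 by rewrite x1 andbT; lra.
apply: (@squeeze_cvgr _ _ _ _ (fun=> 0) (fun n => ((2 * x)^-1) ^+ n)).
- apply: nearW => n; have /andP[-> _]/= := step_poly_itv n x01.
  have xn1 : x ^+ n <= 1 by rewrite exprn_ile1//; lra.
  have xn0 : 0 <= x ^+ n by rewrite exprn_ge0//; lra.
  have := @bernoulli_le (2 ^ n) (x ^+ n); rewrite natrX -exprMn => /(_ _)/wrap[]; first lra.
  move=> B.
  have p0 : 0 < (2 * x) ^+ n by rewrite exprn_gt0//; lra.
  rewrite exprVn -[leRHS]mul1r ler_pdivlMr//.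
  apply: (@le_trans _ _ ((1 - x ^+ n) ^+ (2 ^ n) * (1 + x ^+ n) ^+ (2 ^ n))).
    rewrite /step_poly ler_wpM2l ?exprn_ge0 ?subr_ge0//; lra.
  rewrite -exprMn exprn_ile1//; nra.
- exact: cvg_cst.
- by apply: cvg_expr; rewrite ger0_norm ?invr_ge0 ?invf_lt1; lra.
Qed.

End StepPolynomial.

Section Trigonometric.
Context {R : realType}.

Lemma measurable_cos_affine (A : set (lebesgueType R)) (n : R) theta :
  measurable_fun A (fun t => cos (n * t + theta)).
Proof.
apply: continuous_lebesgue_measurable => t; apply: continuous_comp; last exact: continuous_cos.
apply: cvgD; last exact: cvg_cst.
by apply: cvgM; [exact: cvg_cst|exact: cvg_id].
Qed.

Local Notation lambda := (@completed_lebesgue_measure R).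
Local Notation D := (angles circle : set (lebesgueType R)).
Variable G : R -> R.
Hypothesis iG : lambda.-integrable D (EFin \o G).
Hypothesis G0 : forall (n : int) (theta : R),
  \int[lambda]_(t in D) (G t * cos (n%:~R * t + theta)) = 0.

Let mD := @measurable_angles_circle R.

(** The bounded multipliers that keep all trigonometric moments of [G] equal to
zero.  They form a module over the trigonometric polynomials, so that the
polynomials [step_poly] in a shifted cosine belong to it. *)
Definition moment_free (phi : R -> R) := [/\ measurable_fun D phi,
  exists M, forall t, `|phi t| <= M & forall (n : int) (theta : R),
  \int[lambda]_(t in D) (G t * phi t * cos (n%:~R * t + theta)) = 0].

Lemma integrable_bounded (f phi : R -> R) : lambda.-integrable D (EFin \o f) ->
  measurable_fun D phi -> (exists M, forall t, `|phi t| <= M) ->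
  lambda.-integrable D (EFin \o (fun t => f t * phi t)).
Proof.
move=> fi mphi [M hM]; apply: (integrableMl mD fi mphi).
exists M; split; first exact: num_real.
by move=> x Mx t _; apply: le_trans (hM t) (ltW Mx).
Qed.

Lemma cos_bounded (f : R -> R) : exists M, forall t, `|cos (f t)| <= M.
Proof. by exists 1 => t; rewrite ler_norml cos_geN1 cos_le1. Qed.

Lemma moment_free_integrable phi n theta : moment_free phi ->
  lambda.-integrable D (EFin \o (fun t => G t * phi t * cos (n * t + theta))).
Proof.
move=> [mphi bphi _]; apply: integrable_bounded; last exact: cos_bounded.
  exact: integrable_bounded.
exact: measurable_cos_affine.
Qed.

Lemma moment_free1 : moment_free (cst 1).
Proof.
split; [exact: measurable_cst|by exists 1 => t; rewrite normr1|].
by move=> n theta; under eq_Rintegral do rewrite mulr1; exact: G0.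
Qed.

Lemma moment_freeP a phi psi : moment_free phi -> moment_free psi ->
  moment_free (fun t => a * phi t + psi t).
Proof.
move=> Wphi Wpsi; have [mphi [M hM] Ephi] := Wphi; have [mpsi [M' hM'] Epsi] := Wpsi.
split.
- exact: (measurable_funD (measurable_funM (measurable_cst a) mphi) mpsi).
- exists (`|a| * M + M') => t; apply: le_trans (ler_normD _ _) _.
  by rewrite lerD// normrM ler_wpM2l.
move=> n theta.
rewrite (@eq_Rintegral _ _ _ lambda D (fun t : R => a * (G t * phi t * cos (n%:~R * t + theta)) +
  G t * psi t * cos (n%:~R * t + theta))); last by move=> t _; ring.
have iphi := moment_free_integrable n%:~R theta Wphi.
have ipsi := moment_free_integrable n%:~R theta Wpsi.
rewrite RintegralD//; last exact: integrable_scale.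
by rewrite RintegralZl// Ephi Epsi mulr0 addr0.
Qed.

(** Product-to-sum formula: multiplying by a cosine only shifts the frequency
and the phase of a moment. *)
Lemma moment_freeM c d alpha phi : moment_free phi ->
  moment_free (fun t => phi t * (c + d * cos (t - alpha))).
Proof.
move=> Wphi; have [mphi [M hM] Ephi] := Wphi.
have mcos : measurable_fun D (fun t => c + d * cos (t - alpha)).
  have mc : measurable_fun D (fun t => cos (t - alpha)).
    by under eq_fun do rewrite -[X in X - _]mul1r; exact: measurable_cos_affine.
  exact: (measurable_funD (measurable_cst c) (measurable_funM (measurable_cst d) mc)).
split.
- exact: measurable_funM.
- exists (M * (`|c| + `|d|)) => t; rewrite normrM ler_pM//.
  apply: le_trans (ler_normD _ _) _; rewrite lerD2l// normrM ler_piMr//.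
  by rewrite ler_norml cos_geN1 cos_le1.
move=> n theta.
rewrite (@eq_Rintegral _ _ _ lambda D (fun t : R => c * (G t * phi t * cos (n%:~R * t + theta)) +
  (d / 2) * (G t * phi t * cos ((n + 1)%:~R * t + (theta - alpha)) +
  G t * phi t * cos ((n - 1)%:~R * t + (theta + alpha))))); last first.
  move=> t _.
  have -> : (n + 1)%:~R * t + (theta - alpha) = (n%:~R * t + theta) + (t - alpha).
    by rewrite intrD; ring.
  have -> : (n - 1)%:~R * t + (theta + alpha) = (n%:~R * t + theta) - (t - alpha).
    by rewrite intrD; ring.
  by move: (n%:~R * t + theta) (t - alpha) => u v; rewrite cosB cosD; field.
have i1 := moment_free_integrable n%:~R theta Wphi.
have i2 := moment_free_integrable (n + 1)%:~R (theta - alpha) Wphi.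
have i3 := moment_free_integrable (n - 1)%:~R (theta + alpha) Wphi.
have i23 := integrable_add mD i2 i3.
rewrite RintegralD//; [|exact: integrable_scale|exact: integrable_scale].
by rewrite !RintegralZl// RintegralD// !Ephi addr0 !mulr0 addr0.
Qed.

Lemma moment_free_step c d alpha n :
  moment_free (fun t => step_poly n (c + d * cos (t - alpha))).
Proof.
pose p t := c + d * cos (t - alpha).
have Wpow phi k : moment_free phi -> moment_free (fun t => phi t * p t ^+ k).
  move=> Wphi; elim: k => [|k IH]; first by under eq_fun do rewrite expr0 mulr1.
  by under eq_fun do rewrite exprSr mulrA; exact: moment_freeM.
have Wpow1 phi : moment_free phi -> moment_free (fun t => phi t * (1 - p t ^+ n)).
  move=> Wphi; have := moment_freeP (-1) (Wpow _ n Wphi) Wphi.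
  by congr moment_free; apply/funext => t; ring.
rewrite /step_poly -/(p _); elim: (2 ^ n)%N => [|k IH].
  by under eq_fun do rewrite expr0; exact: moment_free1.
by under eq_fun do rewrite exprSr; exact: Wpow1.
Qed.

(** On [0, 2 pi[ the set ]0, x[ is where a cosine centered at x / 2 exceeds
cos (x / 2), so its indicator is a bounded limit of [step_poly] of a
trigonometric polynomial of degree one. *)
Lemma integral_ray x : (\int[lambda]_(t in D `&` `]-oo, x[) (G t)%:E = 0)%E.
Proof.
have ID : (\int[lambda]_(t in D) (G t)%:E = 0)%E.
  have := G0 0 0; under eq_Rintegral do rewrite mul0r addr0 cos0 mulr1.
  rewrite /Rintegral => /eqP; rewrite fine_eq0; last exact: integrable_fin_num.
  by move=> /eqP.
have [x0|x0] := leP x 0.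
  rewrite (_ : _ `&` _ = set0) ?integral_set0// angles_circle -subset0 => t [] /=.
  rewrite !in_itv/=; lra.
have [x2|x2] := leP (2 * pi) x.
  rewrite setIidl// angles_circle => t /=; rewrite !in_itv/=; lra.
rewrite integral_mkcondr.
(* values in [0, 1], below 1/2 exactly where cos (t - x / 2) > cos (x / 2) *)
pose p (t : R) : R := 2^-1 + cos (x / 2) / 4 + (- 4^-1) * cos (t - x / 2).
have pE t : p t = 2^-1 + sin (t / 2) * sin ((t - x) / 2) / 2.
  have := cosB (t / 2) ((t - x) / 2); have := cosD (t / 2) ((t - x) / 2).
  rewrite (_ : t / 2 + _ = t - x / 2); last by field.
  rewrite (_ : t / 2 - _ = x / 2); last by field.
  by rewrite /p; lra.
have p01 t : 0 <= p t <= 1.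
  rewrite /p; have := cos_geN1 (x / 2); have := cos_le1 (x / 2).
  by have := cos_geN1 (t - x / 2); have := cos_le1 (t - x / 2); lra.
have step0 n : (\int[lambda]_(t in D) (G t * step_poly n (p t))%:E = 0)%E.
  have W := moment_free_step (2^-1 + cos (x / 2) / 4) (- 4^-1) (x / 2) n.
  have [_ _ /(_ 0 0)] := W; under eq_Rintegral do rewrite mul0r addr0 cos0 mulr1.
  rewrite /Rintegral => /eqP; rewrite fine_eq0; first by move=> /eqP.
  apply: integrable_fin_num => //.
  by have [m b _] := W; exact: integrable_bounded.
have cvgD : {ae lambda, forall t, D t ->
   (fun n => (G t * step_poly n (p t))%:E) @ \oo --> ((EFin \o G) \_ `]-oo, x[) t}.
  exists ([set 0] `|` [set x]); split.
  - by apply: measurableU; exact: borel_lebesgue.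
  - apply: null_set_setU; try exact: lambda_set1; exact: borel_lebesgue.
  move=> t /= ht; apply: contrapT => /not_orP[t0 tx]; apply: ht.
  rewrite angles_circle/= in_itv/= => /andP[tge0 t2].
  have tp : 0 < sin (t / 2).
    by apply: sin_gt0_pi; apply/andP; split; [have /eqP := t0|]; lra.
  rewrite /restrict.
  case: ifPn; rewrite ?inE ?notin_setE/= in_itv/= => tx'.
    rewrite -[X in _ --> (X)%:E]mulr1; apply: cvg_EFin; first exact: nearW.
    apply: cvgM; first exact: cvg_cst.
    apply: step_poly_cvg1; have /andP[-> _] := p01 t; rewrite pE.
    have : 0 < sin ((x - t) / 2) by apply: sin_gt0_pi; lra.
    rewrite -[(x - t) / 2]opprK sinN (_ : - ((x - t) / 2) = (t - x) / 2); last by field.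
    by move=> s; rewrite /=; nra.
  rewrite -[X in _ --> X%:E](mulr0 (G t)); apply: cvg_EFin; first exact: nearW.
  apply: cvgM; first exact: cvg_cst.
  apply: step_poly_cvg0; have /andP[_ ->] := p01 t; rewrite andbT pE.
  have : 0 < sin ((t - x) / 2) by apply: sin_gt0_pi; have /eqP := tx; lra.
  by move=> s; rewrite /=; nra.
have [| | | |_ _] := @dominated_convergence _ _ _ lambda D mD
    (fun n t => (G t * step_poly n (p t))%:E) _ (EFin \o (fun t => `|G t|)) _ _ cvgD.
- move=> n; have [mn bn _] := moment_free_step (2^-1 + cos (x / 2) / 4) (- 4^-1) (x / 2) n.
  exact: measurable_int (integrable_bounded iG mn bn).
- have mray : measurable (`]-oo, x[%classic : set (lebesgueType R)) by exact: borel_lebesgue.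
  have [h _] := @measurable_restrict _ _ (lebesgueType R) _ _ D (EFin \o G) mray mD; apply: h.
  by have := measurable_int _ iG; apply: measurable_funS => //; exact: subIsetl.
- exact: integrable_norm.
- apply: aeW => t n _ /=; rewrite lee_fin normrM ler_piMr//.
  by have /andP[s0 s1] := step_poly_itv n (p01 t); rewrite ger0_norm.
under eq_fun do rewrite step0.
by move=> /cvg_lim <-//; rewrite lim_cst.
Qed.

Lemma integral_borel (B : set R) : measurable B ->
  (\int[lambda]_(t in D `&` B) (G t)%:E = 0)%E.
Proof.
have ID : (\int[lambda]_(t in D) (G t)%:E = 0)%E.
  have := integral_ray (2 * pi); rewrite setIidl// angles_circle => t /=.
  by rewrite !in_itv/= => /andP[].
have mDB (S : set R) : measurable S -> measurable (D `&` S : set (lebesgueType R)).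
  by move=> mS; apply: measurableI => //; exact: borel_lebesgue.
have iDB (S : set R) : measurable S -> lambda.-integrable (D `&` S) (EFin \o G).
  by move=> mS; apply: integrableS iG => //; exact: mDB.
rewrite [measurable](@RGenInftyO.measurableE R) => mB.
apply: (@dynkin_induction _ _ (@RGenInftyO.G R)
  (fun S => \int[lambda]_(t in D `&` S) (G t)%:E = 0)%E) mB.
- exact: RGenInftyO.measurableE.
- move=> _ _ [x ->] [y ->]; exists (Num.min x y).
  apply/seteqP; split => t /=; rewrite !in_itv/= lt_min; first by case=> -> ->.
  by move=> /andP[].
- by rewrite setIT.
- by move=> _ [x ->]; exact: integral_ray.
- move=> S mS S0; have := ID; rewrite -[X in integral _ X](setIT D) -(setUv S) setIUr.
  rewrite integral_setU_EFin ?S0 ?add0e//.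
  + exact: mDB.
  + by apply: mDB; exact: measurableC.
  + by rewrite -setIUr setUv setIT; exact/measurable_EFinP/(measurable_int lambda).
  + by apply/disj_setPS => t [[_ St] [_]].
- move=> F mF tF F0; rewrite setI_bigcupr integral_bigcup.
  + by under eq_eseriesr do rewrite F0; rewrite eseries0.
  + exact: trivIset_setIl.
  + by move=> k; exact: mDB.
  + by rewrite -setI_bigcupr; apply: iDB; exact: bigcup_measurable.
Qed.

(** The integral of [G] vanishes over rays, hence over Borel sets, hence over
Lebesgue sets. *)
Lemma trigonometric_uniqueness : {ae lambda, forall t, D t -> G t = 0}.
Proof.
have h : ae_eq lambda D (EFin \o G) (cst 0%E).
  apply: integral_ae_eq => // E ED mE; rewrite integral0.
  have [B [N [mB [C [mC C0 NC]] EBN]]] := lebesgue_borel_negligible mE.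
  have iE : lambda.-integrable E (EFin \o G) by exact: integrableS iG.
  have mDB : measurable (D `&` B : set (lebesgueType R)).
    by apply: measurableI => //; exact: borel_lebesgue.
  rewrite (negligible_integral mC mE iE C0) -(integral_borel mB).
  rewrite [RHS](negligible_integral mC mDB)//; last exact: integrableS iG.
  congr (integral _ _ _); apply/seteqP; split => t /=.
    move=> [Et nC]; split => //; split; first exact: ED.
    by move: Et; rewrite EBN => -[//|/NC].
  by move=> [[Dt Bt] nC]; split => //; rewrite EBN; left.
by apply: filterS h => t /= + Dt => /(_ Dt) [].
Qed.

End Trigonometric.

(** * The semi-inner product over a piece of the circle *)

Section CircleL2.
Context {R : realType}.
Local Notation lambda := (@completed_lebesgue_measure R).
Local Notation E := (R[i] -> Rcomplex R).
Local Notation C := (R[i]).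
Implicit Types (A : set C) (F G : C -> C).

(** Functions on the circle enter integrals through the real and imaginary parts
of their pullbacks by t |-> exp(i t). *)
Definition re F (t : R) : R := complex.Re (F (expi t)).
Definition im F (t : R) : R := complex.Im (F (expi t)).

(** The real part of the inner product of L^2(A).  Complex orthogonality is
recovered by testing also against [monomial 0 (pi / 2)] times a function,
which is multiplication by i. *)
Definition dot A F G : R :=
  (2 * pi)^-1 * \int[lambda]_(t in angles A) (re F t * re G t + im F t * im G t).

Lemma expi_circle (t : R) : circle (expi t).
Proof. by rewrite /circle/= /expi normc_def/= cos2Dsin2 sqrtr1. Qed.

Lemma angles_sub A : angles A `<=` angles circle.
Proof. by move=> t [t2 _]; split => //; exact: expi_circle. Qed.

Lemma normc_sqr (x : C) : Normc.normc x ^+ 2 = complex.Re x ^+ 2 + complex.Im x ^+ 2.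
Proof. by case: x => a b /=; rewrite sqr_sqrtr// addr_ge0 ?sqr_ge0. Qed.

Lemma L2P A F : circle_measurable A ->
  L2 A F <-> square_integrable lambda (angles A) (re F) /\
             square_integrable lambda (angles A) (im F).
Proof.
move=> mA; have msqr (f : R -> R) : measurable_fun (angles A : set (lebesgueType R)) f ->
    measurable_fun (angles A : set (lebesgueType R)) (EFin \o (fun t => f t ^+ 2)).
  by move=> mf; apply/measurable_EFinP; exact: measurable_funX.
split.
  move=> [[mre mim] fin].
  have dom (f : R -> R) : measurable_fun (angles A : set (lebesgueType R)) f ->
      (forall t, f t ^+ 2 <= Normc.normc (F (expi t)) ^+ 2) ->
      square_integrable lambda (angles A) f.
    move=> mf fF; split => //; apply/integrableP; split; first exact: msqr.
    apply: le_lt_trans fin; apply: ge0_le_integral.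
    - exact: mA.
    - by move=> t _; exact: abse_ge0.
    - exact: (measurableT_comp (@abse_measurable R setT) (msqr _ mf)).
    - under eq_fun do rewrite normc_sqr.
      by apply/measurable_EFinP; apply: measurable_funD; exact: measurable_funX.
    - by move=> t _ /=; rewrite lee_fin ger0_norm ?sqr_ge0.
  by split; apply: dom => // t; rewrite normc_sqr ?lerDl ?lerDr sqr_ge0.
move=> [[mre ire] [mim iim]]; split => //.
under eq_integral do rewrite normc_sqr.
have /integrableP[_] := integrable_add mA ire iim.
apply: le_lt_trans; rewrite le_eqVlt; apply/orP; left; apply/eqP.
by apply: eq_integral => t _ /=; rewrite ger0_norm// addr_ge0 ?sqr_ge0.
Qed.

Lemma reP a (F G : E) t : re (a *: F + G) t = a * re F t + re G t.
Proof. by rewrite /re [(_ + _) _]/(_ *: _ + _); case: (F _) => ? ?; case: (G _). Qed.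

Lemma imP a (F G : E) t : im (a *: F + G) t = a * im F t + im G t.
Proof. by rewrite /im [(_ + _) _]/(_ *: _ + _); case: (F _) => ? ?; case: (G _). Qed.

Lemma reZ a (F : E) t : re (a *: F) t = a * re F t.
Proof. by rewrite /re [(_ *: _) _]/(_ *: _); case: (F _). Qed.

Lemma imZ a (F : E) t : im (a *: F) t = a * im F t.
Proof. by rewrite /im [(_ *: _) _]/(_ *: _); case: (F _). Qed.

Lemma re0 t : re (0 : E) t = 0. Proof. by []. Qed.
Lemma im0 t : im (0 : E) t = 0. Proof. by []. Qed.

Lemma reB (F G : E) t : re (F - G) t = re F t - re G t.
Proof. by rewrite /re [(_ - _) _]/(_ - _); case: (F _) => ? ?; case: (G _). Qed.

Lemma imB (F G : E) t : im (F - G) t = im F t - im G t.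
Proof. by rewrite /im [(_ - _) _]/(_ - _); case: (F _) => ? ?; case: (G _). Qed.

Section Piece.
Variable A : set C.
Hypothesis mA : circle_measurable A.

Lemma L2_subspace : subspace (L2 A : set E).
Proof.
split.
  apply/(L2P _ mA); split; split; try exact: measurable_cst;
  by under eq_fun do rewrite ?re0 ?im0 expr0n/=; exact: integrable0.
move=> a F G /(L2P _ mA)[rF iF] /(L2P _ mA)[rG iG]; apply/(L2P _ mA); split.
  by have := square_integrableP mA a rF rG; congr square_integrable; apply/funext => t; rewrite reP.
by have := square_integrableP mA a iF iG; congr square_integrable; apply/funext => t; rewrite imP.
Qed.

Lemma dot_integrable F G : L2 A F -> L2 A G ->
  lambda.-integrable (angles A) (EFin \o (fun t => re F t * re G t + im F t * im G t)).
Proof.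
move=> /(L2P _ mA)[rF iF] /(L2P _ mA)[rG iG].
by apply: integrable_add => //; exact: square_integrableM.
Qed.

Lemma dot_semi_inner : semi_inner (L2 A : set E) (dot A).
Proof.
split=> [F G LF LG|a F G H LF LG LH|F LF].
- by congr (_ * _); apply: eq_Rintegral => t _; ring.
- rewrite /dot (@eq_Rintegral _ _ _ lambda (angles A) (fun t => a * (re F t * re H t + im F t * im H t) +
    (re G t * re H t + im G t * im H t))); last by move=> t _; rewrite reP imP; ring.
  have i1 := dot_integrable LF LH; have i2 := dot_integrable LG LH.
  rewrite RintegralD// ?RintegralZl//; last exact: integrable_scale.
  by rewrite mulrDr; ring.
- rewrite /dot mulr_ge0 ?invr_ge0 ?mulr_ge0 ?pi_ge0//.
  by apply: Rintegral_ge0 => t _; rewrite -!expr2 addr_ge0 ?sqr_ge0.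
Qed.

Lemma dot_sqrE F : dot A F F = (2 * pi)^-1 *
  \int[lambda]_(t in angles A) (Normc.normc (F (expi t)) ^+ 2).
Proof. by congr (_ * _); apply: eq_Rintegral => t _; rewrite normc_sqr -!expr2. Qed.

Lemma L2normE F : L2norm A F = Num.sqrt (dot A F F).
Proof. by rewrite dot_sqrE. Qed.

Lemma dot_eq0 F : L2 A F -> dot A F F = 0 -> circle_ae_eq A F (cst 0).
Proof.
move=> LF; rewrite /dot => /eqP; rewrite mulf_eq0 invr_eq0 mulf_eq0 pnatr_eq0/=.
rewrite (gt_eqF (pi_gt0 R))/= => /eqP.
have iF := dot_integrable LF LF.
rewrite /Rintegral => /eqP; rewrite fine_eq0; last exact: integrable_fin_num.
move=> /eqP I0.
have : ae_eq lambda (angles A) (EFin \o (fun t => re F t * re F t + im F t * im F t)) (cst 0%E).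
  apply/(ae_eq_integral_abs _ mA); first exact: (measurable_int _ iF).
  rewrite -[RHS]I0; apply: eq_integral => t _ /=.
  by rewrite ger0_norm// -!expr2 addr_ge0 ?sqr_ge0.
apply: filterS => t + At => /(_ At)[]; rewrite /re /im.
case: (F (expi t)) => a b /= /eqP; rewrite -!expr2 paddr_eq0 ?sqr_ge0// !sqrf_eq0.
by move=> /andP[/eqP-> /eqP->].
Qed.

Lemma dot_congr F F' G G' : circle_ae_eq A F F' -> circle_ae_eq A G G' ->
  circle_measurable_fun A F -> circle_measurable_fun A G ->
  circle_measurable_fun A F' -> circle_measurable_fun A G' ->
  dot A F G = dot A F' G'.
Proof.
move=> FF' GG' [mF1 mF2] [mG1 mG2] [mF1' mF2'] [mG1' mG2']; congr (_ * fine _).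
apply: ae_eq_integral.
- exact: mA.
- by apply/measurable_EFinP; apply: measurable_funD; exact: measurable_funM.
- by apply/measurable_EFinP; apply: measurable_funD; exact: measurable_funM.
apply: filterS2 FF' GG' => t hF hG At.
by rewrite /re /im hF// hG.
Qed.

End Piece.

Lemma L2_sub A B F : circle_measurable A -> circle_measurable B ->
  A `<=` B -> L2 B F -> L2 A F.
Proof.
move=> mA mB AB /(L2P _ mB)[[mr ir] [mi ii]].
have sAB : angles A `<=` angles B by move=> t [? /AB].
apply/(L2P _ mA); split; split.
- exact: measurable_funS mr.
- exact: integrableS ir.
- exact: measurable_funS mi.
- exact: integrableS ii.
Qed.

End CircleL2.

Section Pieces.
Context {R : realType}.
Local Notation lambda := (@completed_lebesgue_measure R).
Local Notation E := (R[i] -> Rcomplex R).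
Local Notation C := (R[i]).
Implicit Types (A : set C) (F G : C -> C).

Lemma square_integrable_setU (X Y : set (lebesgueType R)) (f : R -> R) :
  measurable X -> measurable Y -> [disjoint X & Y] ->
  square_integrable lambda X f -> square_integrable lambda Y f ->
  square_integrable lambda (X `|` Y) f.
Proof.
move=> mX mY XY [mf1 i1] [mf2 i2]; have mf : measurable_fun (X `|` Y) f.
  exact/measurable_funU.
have mf2' : measurable_fun (X `|` Y) (EFin \o (fun t => f t ^+ 2)).
  by apply/measurable_EFinP; exact: measurable_funX.
split => //; apply/integrableP; split=> //.
have mabs := measurableT_comp (@abse_measurable R setT) mf2'.
rewrite (ge0_integral_setU _ mX mY mabs (fun t _ => abse_ge0 _) XY).
by apply: lte_add_pinfty; [case/integrableP: i1|case/integrableP: i2].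
Qed.

Lemma square_integrable_eq (X : set (lebesgueType R)) (f g : R -> R) :
  measurable X -> (forall t, X t -> f t = g t) ->
  square_integrable lambda X f -> square_integrable lambda X g.
Proof.
move=> mX fg [mf if2]; split.
  by apply: eq_measurable_fun mf => t; rewrite inE; exact: fg.
by apply: eq_integrable if2 => // t; rewrite inE => /fg/= ->.
Qed.

Lemma angles_setD A : angles (circle `\` A) = angles circle `\` angles A.
Proof.
apply/seteqP; split => [t [t2 [ct nA]]|t [[t2 ct] nA]]; split => //; first by case.
by split => // At; exact: nA.
Qed.

Lemma circle_measurableT : circle_measurable (circle : set C).
Proof. exact: measurable_angles_circle. Qed.

Lemma circle_measurableD A : circle_measurable A -> circle_measurable (circle `\` A).
Proof.
by move=> mA; rewrite /circle_measurable angles_setD; apply: measurableD => //; exact: circle_measurableT.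
Qed.

Lemma angles_setUD A : angles circle = angles A `|` angles (circle `\` A).
Proof. by rewrite angles_setD setDUK//; exact: angles_sub. Qed.

Lemma angles_disjD A : [disjoint angles A & angles (circle `\` A)].
Proof. by rewrite angles_setD; apply/disj_setPS => t [At [_ /(_ At)]]. Qed.

Lemma L2_eq A F G : circle_measurable A -> (forall t, angles A t -> F (expi t) = G (expi t)) ->
  L2 A F -> L2 A G.
Proof.
move=> mA FG /(L2P _ mA)[rF iF]; apply/(L2P _ mA); split.
  by apply: (square_integrable_eq mA) rF => t At; rewrite /re FG.
by apply: (square_integrable_eq mA) iF => t At; rewrite /im FG.
Qed.

Lemma L2_vee A F G : circle_measurable A ->
  L2 A F -> L2 (circle `\` A) G -> L2 circle (vee A F G).
Proof.
move=> mA LF LG; have mD := circle_measurableD mA.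
have LF' : L2 A (vee A F G).
  by apply: L2_eq LF => // t [_ At]; rewrite /vee mem_set.
have LG' : L2 (circle `\` A) (vee A F G).
  by apply: L2_eq LG => // t [_ [_ At]]; rewrite /vee memNset.
have [rF iF] := (L2P _ mA).1 LF'; have [rG iG] := (L2P _ mD).1 LG'.
by apply/(L2P _ circle_measurableT); rewrite (angles_setUD A);
  split; apply: square_integrable_setU => //; exact: angles_disjD.
Qed.

Lemma L2_piece A F : circle_measurable A -> A `<=` circle -> L2 circle F -> L2 A F.
Proof. by move=> mA AC; apply: L2_sub => //; exact: circle_measurableT. Qed.

Lemma dotD A F G : circle_measurable A -> L2 circle F -> L2 circle G ->
  dot circle F G = dot A F G + dot (circle `\` A) F G.
Proof.
move=> mA LF LG; rewrite /dot -mulrDr (angles_setUD A) Rintegral_setU//.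
- exact: circle_measurableD.
- by rewrite -angles_setUD; apply: dot_integrable => //; exact: circle_measurableT.
- exact: angles_disjD.
Qed.

Lemma dot_eq A F F' G G' : (forall t, angles A t -> F (expi t) = F' (expi t)) ->
  (forall t, angles A t -> G (expi t) = G' (expi t)) -> dot A F G = dot A F' G'.
Proof.
move=> FF GG; congr (_ * _); apply: eq_Rintegral => t; rewrite inE => At.
by rewrite /re /im FF// GG.
Qed.

(** If cos (t - s) = 1 then sin ((t - s) / 2) = 0, where (t - s) / 2 lies in
[0, pi[. *)
Lemma expi_inj (s t : R) : 0 <= s < 2 * pi -> 0 <= t < 2 * pi -> expi s = expi t -> s = t.
Proof.
wlog st : s t / s <= t => [H|/andP[s0 s2] /andP[t0 t2] [ec es]].
  move=> hs ht e; have [/H|/ltW/H] := leP s t; first exact.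
  by move=> /(_ ht hs (esym e)).
have c1 : cos (t - s) = 1 by rewrite cosB ec es -!expr2 cos2Dsin2.
have : sin ((t - s) / 2) = 0.
  apply/eqP; rewrite -sqrf_eq0; apply/eqP.
  have := cosD ((t - s) / 2) ((t - s) / 2); have := cos2Dsin2 ((t - s) / 2).
  rewrite -splitr c1 -!expr2; lra.
have [->//|ts] := eqVneq s t.
have : 0 < sin ((t - s) / 2).
  by apply: sin_gt0_pi; have : s < t by [rewrite lt_neqAle ts]; lra.
lra.
Qed.

Lemma circle_function (a b : R -> R) : exists F : C -> C,
  forall t, 0 <= t < 2 * pi -> re F t = a t /\ im F t = b t.
Proof.
pose arg w := xget 0 [set t : R | 0 <= t < 2 * pi /\ expi t = w].
exists (fun w => (a (arg w) +i* b (arg w))%C) => t t2.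
suff tE : arg (expi t) = t by rewrite /re /im/= tE.
rewrite /arg; case: xgetP => [s _ [s2 est]|/(_ t)]; last by case.
exact: expi_inj.
Qed.

(** Limits of the real and imaginary parts over [A] are functions of the angle;
they are carried back to the circle and extended by 0 outside [A]. *)
Lemma L2_complete A : circle_measurable A -> A `<=` circle ->
  @complete_for R E (dot A) (L2 circle).
Proof.
move=> mA AC u Lu cu.
have LA n : L2 A (u n) by exact: L2_piece.
have sre n := ((L2P _ mA).1 (LA n)).1; have sim n := ((L2P _ mA).1 (LA n)).2.
have pi2 : 0 < 2 * pi :> R by rewrite mulr_gt0 ?pi_gt0.
have dotE (F G : E) : L2 A F -> L2 A G -> dot A (F - G) (F - G) = (2 * pi)^-1 *
    (\int[lambda]_(t in angles A) ((re F t - re G t) ^+ 2) +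
     \int[lambda]_(t in angles A) ((im F t - im G t) ^+ 2)).
  move=> /(L2P _ mA)[rF iF] /(L2P _ mA)[rG iG].
  have [_ i1] := square_integrableB mA rF rG; have [_ i2] := square_integrableB mA iF iG.
  rewrite -RintegralD//; congr (_ * _); apply: eq_Rintegral => t _.
  by rewrite reB imB !expr2.
have sq0 (f : R -> R) : 0 <= \int[lambda]_(t in angles A) (f t ^+ 2).
  by apply: Rintegral_ge0 => t _; exact: sqr_ge0.
have cauchy : forall e, 0 < e -> exists n0, forall m n, (n0 <= m)%N -> (n0 <= n)%N ->
   \int[lambda]_(t in angles A) ((re (u m) t - re (u n) t) ^+ 2) +
   \int[lambda]_(t in angles A) ((im (u m) t - im (u n) t) ^+ 2) < e.
  move=> e e0; have e1 : 0 < (2 * pi)^-1 * e by rewrite mulr_gt0 ?invr_gt0.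
  have [n0 h] := cu _ e1; exists n0 => m n hm hn; have := h m n hm hn.
  by rewrite dotE// ltr_pM2l ?invr_gt0.
have [|a sa ha] := @square_integrable_complete _ _ _ lambda _ mA (fun n => re (u n)) sre.
  move=> e /cauchy[n0 h]; exists n0 => m n hm hn; apply: le_lt_trans (h m n hm hn).
  by rewrite lerDl.
have [|b sb hb] := @square_integrable_complete _ _ _ lambda _ mA (fun n => im (u n)) sim.
  move=> e /cauchy[n0 h]; exists n0 => m n hm hn; apply: le_lt_trans (h m n hm hn).
  by rewrite lerDr.
have [F hF] := circle_function a b.
have LF : L2 A F.
  apply/(L2P _ mA); split.
    by apply: (square_integrable_eq mA) sa => t [/hF[-> _]].
  by apply: (square_integrable_eq mA) sb => t [/hF[_ ->]].
pose F0 := vee A F (cst 0).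
have LF0 : L2 circle F0.
  apply: L2_vee => //; exact: (L2_subspace (circle_measurableD mA)).1.
have LF0A := L2_piece mA AC LF0.
exists F0 => // e e0.
have e1 : 0 < (2 * pi) * e / 2 by rewrite divr_gt0// mulr_gt0.
have [n1 h1] := ha _ e1; have [n2 h2] := hb _ e1.
exists (maxn n1 n2) => n; rewrite geq_max => /andP[/h1 {}h1 /h2 {}h2].
have F0E t : angles A t -> re F0 t = a t /\ im F0 t = b t.
  move=> [t2 At]; have [<- <-] := hF _ t2.
  by rewrite /re /im /F0 /vee mem_set.
rewrite dotE// mulrC ltr_pdivrMr// mulrC.
rewrite (@eq_Rintegral _ _ _ lambda (angles A) (fun t => (re (u n) t - a t) ^+ 2)); last first.
  by move=> t; rewrite inE => /F0E[->].
rewrite [X in _ + X](@eq_Rintegral _ _ _ lambda (angles A) (fun t => (im (u n) t - b t) ^+ 2)); last first.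
  by move=> t; rewrite inE => /F0E[_ ->].
lra.
Qed.

Lemma dot_semi_inner_circle A : circle_measurable A -> A `<=` circle ->
  semi_inner (L2 circle : set E) (dot A).
Proof.
move=> mA AC; have sA := dot_semi_inner mA; split.
- move=> F G LF LG; exact: (semi_innerC sA (L2_piece mA AC LF) (L2_piece mA AC LG)).
- move=> a F G H LF LG LH.
  exact: (semi_innerP sA a (L2_piece mA AC LF) (L2_piece mA AC LG) (L2_piece mA AC LH)).
- move=> F LF; exact: (semi_inner_ge0 sA (L2_piece mA AC LF)).
Qed.

End Pieces.

(** * Monomials and unimodular multipliers *)

Section CosIntegral.
Context {R : realType}.
Local Notation lambda := (@completed_lebesgue_measure R).

(** The completed measure pushed forward to the Borel sets by the identity is
Lebesgue measure, so the fundamental theorem of calculus applies to continuous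
integrands. *)
Lemma completed_integral (D : set R) (f : R -> R) : measurable D ->
  measurable_fun setT f -> lambda.-integrable D (EFin \o f) ->
  (\int[lambda]_(t in D) (f t)%:E = \int[@lebesgue_measure R]_(t in D) (f t)%:E)%E.
Proof.
move=> mD mf fi.
pose phi : lebesgueType R -> measurableTypeR R := id.
have mphi : measurable_fun setT phi by move=> _ Y mY; rewrite setTI; exact: borel_lebesgue.
have mEf : measurable_fun [set: measurableTypeR R] (EFin \o f) by exact/measurable_EFinP.
have := @integral_pushforward _ _ _ _ R phi mphi lambda D (EFin \o f) mEf fi mD.
rewrite [RHS](_ : _ = \int[lambda]_(t in D) (f t)%:E)%E// => <-.
Qed.

Lemma integral_cos_circle (n : int) theta : n != 0 ->
  \int[lambda]_(t in angles circle) cos (n%:~R * t + theta) = 0.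
Proof.
move=> n0; have nR : n%:~R != 0 :> R by rewrite intr_eq0.
pose f (t : R) : R := cos (n%:~R * t + theta).
pose F (t : R) : R := n%:~R^-1 * sin (n%:~R * t + theta).
have cf : continuous f.
  move=> t; apply: continuous_comp; last exact: continuous_cos.
  by apply: cvgD; [apply: cvgM; [exact: cvg_cst|exact: cvg_id]|exact: cvg_cst].
have dF (t : R) : is_derive t 1 F (f t).
  rewrite /F /f.
  have d1 : is_derive t 1 (fun t : R => n%:~R * t + theta) n%:~R.
    by apply: is_derive_eq; rewrite addr0 /GRing.scale/= mulr1.
  have := @is_derive1_comp _ sin (fun t : R => n%:~R * t + theta) t _ _ (is_derive_sin _) d1.
  move=> d2; apply: is_derive_eq.
  by rewrite /GRing.scale/= mulrCA mulVf ?mulr1.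
have pi2 : 0 < 2 * pi :> R by rewrite mulr_gt0 ?pi_gt0.
have cF : continuous F.
  by move=> t; apply: differentiable_continuous; apply/derivable1_diffP; exact: ex_derive.
have mf : measurable_fun setT (f : R -> measurableTypeR R) by exact: continuous_measurable_fun.
have fi : lambda.-integrable (angles circle) (EFin \o f).
  apply: measurable_bounded_integrable.
  - exact: measurable_angles_circle.
  - exact: lambda_circle_lty.
  - exact: continuous_lebesgue_measurable.
  - exists 1; split; first exact: num_real.
    move=> x x1 t _; apply: le_trans (ltW x1).
    by rewrite ler_norml cos_geN1 cos_le1.
rewrite /Rintegral completed_integral//; last by rewrite angles_circle.
rewrite angles_circle integral_itv_bndo_bndc; last first.
  by apply/measurable_EFinP; exact: measurable_funS mf.
rewrite (@continuous_FTC2 _ f F)//.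
- have -> : F (2 * pi) = F 0; last by rewrite subee.
  rewrite /F mulr0 add0r; congr (_ * _).
  have P (m : nat) (x : R) : sin (m%:R * (2 * pi) + x) = sin x.
    by rewrite !mulr_natl addrC (periodicn (@sinD2pi R)).
  case: n {n0 nR f F cf dF cF mf fi} => m; first exact: P.
  rewrite NegzE mulrNz mulNr.
  by have := P m.+1 (- (m.+1%:R * (2 * pi)) + theta); rewrite addNKr => ->.
- exact: continuous_subspaceT.
- split; first by move=> t _; exact: ex_derive.
  + by apply: cvg_at_right_filter; exact: cF.
  + by apply: cvg_at_left_filter; exact: cF.
- by move=> t _; rewrite derive1E; exact: derive_val.
Qed.
End CosIntegral.

Section Hardy.
Context {R : realType}.
Local Notation lambda := (@completed_lebesgue_measure R).
Local Notation E := (R[i] -> Rcomplex R).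
Local Notation C := (R[i]).
Implicit Types (A : set C) (F G u : C -> C).

Lemma expiD (s t : R) : expi (s + t) = expi s * expi t.
Proof. by rewrite /expi cosD sinD; congr (_ +i* _)%C; ring. Qed.

Lemma expi0 : expi (0 : R) = 1. Proof. by rewrite /expi cos0 sin0. Qed.

Lemma expi_unit (t : R) : expi t \is a GRing.unit.
Proof.
apply/unitrP; exists (expi (- t)).
by rewrite -!expiD subrr addNr expi0.
Qed.

Lemma expiV (t : R) : (expi t)^-1 = expi (- t).
Proof. by apply: (mulrI (expi_unit t)); rewrite mulrV ?expi_unit// -expiD subrr expi0. Qed.

Lemma expi_conj (t : R) : conjc (expi t) = expi (- t).
Proof. by rewrite /expi cosN sinN. Qed.

Lemma expiX (t : R) (n : int) : expi t ^ n = expi (n%:~R * t).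
Proof.
have P (m : nat) : expi t ^+ m = expi (m%:R * t).
  elim: m => [|m IH]; first by rewrite mul0r expi0 expr0.
  by rewrite exprS IH -expiD -natr1 mulrDl mul1r addrC.
case: n => m; first exact: P.
by rewrite NegzE -exprnN P expiV -mulNr mulrNz.
Qed.

(** The phase lets a single real form express a complex Fourier coefficient: the
real and imaginary parts of [fourier F n] are obtained for the phases 0 and
pi / 2. *)
Definition monomial (n : int) (theta : R) : C -> C := fun w => expi theta * w ^ n.

Lemma monomialE n theta t : monomial n theta (expi t) = expi (n%:~R * t + theta).
Proof. by rewrite /monomial expiX -expiD addrC. Qed.

Lemma re_monomial n theta t : re (monomial n theta) t = cos (n%:~R * t + theta).
Proof. by rewrite /re monomialE. Qed.

Lemma im_monomial n theta t : im (monomial n theta) t = sin (n%:~R * t + theta).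
Proof. by rewrite /im monomialE. Qed.

Definition unimodular A u := circle_measurable_fun A u /\
  forall t, angles A t -> Normc.normc (u (expi t)) = 1.

Lemma reM F G t : re (F \* G) t = re F t * re G t - im F t * im G t.
Proof. by rewrite /re /im /=; case: (F _) => a b; case: (G _). Qed.

Lemma imM F G t : im (F \* G) t = re F t * im G t + im F t * re G t.
Proof. by rewrite /re /im /=; case: (F _) => a b; case: (G _). Qed.

Lemma circle_measurable_funM A F G : circle_measurable_fun A F -> circle_measurable_fun A G ->
  circle_measurable_fun A (F \* G).
Proof.
move=> [rF iF] [rG iG]; split.
  by apply: eq_measurable_fun (measurable_funB (measurable_funM rF rG) (measurable_funM iF iG)) => t _;
    rewrite -[RHS]/(re _ _) reM.
by apply: eq_measurable_fun (measurable_funD (measurable_funM rF iG) (measurable_funM iF rG)) => t _;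
  rewrite -[RHS]/(im _ _) imM.
Qed.

Lemma L2_unimodular A u F : circle_measurable A -> unimodular A u -> L2 A F -> L2 A (u \* F).
Proof.
move=> mA [mu u1] [mF fF]; split; first exact: circle_measurable_funM.
apply: le_lt_trans fF; rewrite le_eqVlt; apply/orP; left; apply/eqP.
apply: eq_integral => t; rewrite inE => At /=.
by rewrite Normc.normcM u1// mul1r.
Qed.

Lemma dot_unimodular A u F G : unimodular A u -> dot A (u \* F) (u \* G) = dot A F G.
Proof.
move=> [_ u1]; congr (_ * _); apply: eq_Rintegral => t; rewrite inE => At.
rewrite !reM !imM; have := normc_sqr (u (expi t)); rewrite u1// expr1n.
rewrite -/(re u t) -/(im u t) => e.
by rewrite -[RHS]mul1r e; ring.
Qed.

Lemma unimodular_monomial n theta A : unimodular A (monomial n theta).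
Proof.
split=> [|t _].
  split.
    under eq_fun do rewrite -/(re _ _) re_monomial.
    exact: measurable_cos_affine.
  under eq_fun do rewrite -/(im _ _) im_monomial -[X in sin X](subrK (pi / 2)) sinDpihalf -addrA.
  exact: measurable_cos_affine.
by rewrite monomialE /expi/= cos2Dsin2 sqrtr1.
Qed.

End Hardy.

(** * The Hardy space *)

Section Hardy.
Context {R : realType}.
Local Notation lambda := (@completed_lebesgue_measure R).
Local Notation E := (R[i] -> Rcomplex R).
Local Notation C := (R[i]).
Implicit Types (A : set C) (F G u : C -> C).

Let mT := @circle_measurableT R.
Let LT := L2_subspace mT.
Let sT := dot_semi_inner mT.

Lemma L2_monomial n theta : L2 circle (monomial n theta : C -> C).
Proof.
have [mm m1] := unimodular_monomial n theta (circle : set C); split=> //.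
rewrite (@eq_integral _ _ _ lambda _ (cst 1%E)).
  by rewrite integral_cst ?mul1e; [exact: lambda_circle_lty|exact: measurable_angles_circle].
by move=> t; rewrite inE => /m1 ->; rewrite expr1n.
Qed.

Lemma L2innerE F G : L2inner F G =
  (dot circle F G +i* dot circle F (monomial 0 (pi / 2) \* G))%C.
Proof.
rewrite /L2inner /circle_integral; congr (_ * _ +i* (_ * _))%C.
  apply: eq_Rintegral => t _ /=; rewrite /re /im.
  by case: (F _) (G _) => a b [c d] /=; ring.
apply: eq_Rintegral => t _ /=.
rewrite reM imM re_monomial im_monomial mul0r add0r cos_pihalf sin_pihalf /re /im.
by case: (F _) (G _) => a b [c d] /=; ring.
Qed.

Lemma fourierE F n : fourier F n =
  (dot circle F (monomial n 0) +i* dot circle F (monomial n (pi / 2)))%C.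
Proof.
rewrite /fourier /circle_integral; congr (_ * _ +i* (_ * _))%C;
  apply: eq_Rintegral => t _ /=; rewrite re_monomial im_monomial expiX rmorphN/= mulNr /expi cosN sinN /re /im.
  by rewrite addr0; case: (F _) => a b /=; ring.
rewrite cosD sinD cos_pihalf sin_pihalf.
by case: (F _) => a b /=; ring.
Qed.

Lemma dot_monomial_phase F n theta : L2 circle F -> dot circle F (monomial n theta) =
  cos theta * dot circle F (monomial n 0) + sin theta * dot circle F (monomial n (pi / 2)).
Proof.
move=> LF; have L0 := L2_monomial n 0; have L1 := L2_monomial n (pi / 2).
have -> : dot circle F (monomial n theta) =
  dot circle F ((cos theta *: (monomial n 0 : E) : E) + (sin theta *: (monomial n (pi / 2) : E) : E)).
  congr (_ * _); apply: eq_Rintegral => t _.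
  rewrite reP imP reZ imZ !re_monomial !im_monomial.
  move: (n%:~R * t) (re F t) (im F t) => x a b.
  rewrite addr0 (cosD x theta) (sinD x theta) (cosD x (pi / 2)) (sinD x (pi / 2)).
  rewrite cos_pihalf sin_pihalf.
  move: (cos x) (sin x) (cos theta) (sin theta) => c s c' s'; ring.
have Lc := subspaceZ LT (cos theta) L0; have Ls := subspaceZ LT (sin theta) L1.
rewrite (semi_innerDr LT sT LF Lc Ls).
by rewrite (semi_innerZr LT sT _ LF L0) (semi_innerZr LT sT _ LF L1).
Qed.

Lemma hardyP F : hardy F <->
  L2 circle F /\ forall n : int, n < 0 -> forall theta, dot circle F (monomial n theta) = 0.
Proof.
split=> -[LF hF]; split => // n n0.
  move=> theta; rewrite dot_monomial_phase//.
  by have := hF n n0; rewrite fourierE => -[-> ->]; rewrite !mulr0 addr0.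
by rewrite fourierE !hF.
Qed.

Lemma hardy_subspace : subspace (hardy : set E).
Proof.
split.
  apply/hardyP; split; first exact: LT.1.
  by move=> n _ theta; exact: (semi_inner0l LT sT (L2_monomial n theta)).
move=> a F G /hardyP[LF hF] /hardyP[LG hG]; apply/hardyP; split; first exact: LT.2.
move=> n n0 theta; have Lm := L2_monomial n theta.
by rewrite (semi_innerP sT _ LF LG Lm) (hF _ n0) (hG _ n0) mulr0 addr0.
Qed.

Lemma hardy_L2 F : hardy F -> L2 circle F. Proof. by case. Qed.

Lemma dot_limit A (u : nat -> E) (F G : E) : circle_measurable A ->
  (forall n, L2 A (u n)) -> L2 A F -> L2 A G ->
  @converges_for R E (dot A) u F -> (forall n, dot A (u n) G = 0) -> dot A F G = 0.
Proof.
move=> mA Lu LF LG uF u0.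
have LA := L2_subspace mA; have sA := dot_semi_inner mA.
suff : dot A F G ^+ 2 <= 0.
  by move=> h; apply/eqP; rewrite -sqrf_eq0 eq_le h sqr_ge0.
apply/ler_addgt0Pr => e e0; rewrite add0r.
have G0 : 0 <= dot A G G by exact: (semi_inner_ge0 sA).
have e1 : 0 < e / (dot A G G + 1) by rewrite divr_gt0//; lra.
have [n h] := uF _ e1; have {}h := h n (leqnn n).
have := cauchy_schwarz LA sA (subspaceB LA (Lu n) LF) LG.
rewrite (semi_innerBl sA (Lu n) LF LG) u0 sub0r sqrrN => /le_trans; apply.
apply: (@le_trans _ _ (e / (dot A G G + 1) * (dot A G G + 1))); last first.
  by rewrite divfK// gt_eqF//; lra.
apply: ler_pM => //; [|exact: ltW|lra].
by apply: (semi_inner_ge0 sA); exact: subspaceB.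
Qed.

(** Membership in H^2 is a family of equations dot F e = 0, which are preserved by
limits. *)
Lemma hardy_complete : @complete_for R E (dot circle) hardy.
Proof.
move=> u hu cu.
have [F LF uF] := L2_complete mT (@subset_refl _ _) (fun n => hardy_L2 (hu n)) cu.
exists F => //; apply/hardyP; split => // n n0 theta.
apply: (dot_limit mT (fun n => hardy_L2 (hu n)) LF _ uF); first exact: L2_monomial.
by move=> k; have [_] := (hardyP _).1 (hu k); exact.
Qed.

Lemma dot_shift F n theta m tau : dot circle (monomial n theta \* F) (monomial m tau) =
  dot circle F (monomial (m - n) (tau - theta)).
Proof.
rewrite -(dot_unimodular F _ (unimodular_monomial n theta circle)).
apply: dot_eq => // t _; rewrite /= !monomialE -expiD; congr expi.
by rewrite rmorphB/=; ring.
Qed.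

Lemma hardy_shift F (n : nat) theta : hardy F -> hardy (monomial n theta \* F).
Proof.
move=> /hardyP[LF hF]; apply/hardyP; split.
  exact: (L2_unimodular mT (unimodular_monomial _ _ _) LF).
by move=> m m0 tau; rewrite dot_shift; apply: hF; rewrite subr_lt0; exact: lt_le_trans m0 _.
Qed.

Lemma hardy_monomial (n : nat) theta : hardy (monomial n theta : C -> C).
Proof.
apply/hardyP; split; first exact: L2_monomial.
move=> m m0 tau.
have -> : dot circle (monomial n theta) (monomial m tau) = (2 * pi)^-1 *
   \int[lambda]_(t in angles circle) cos ((n%:Z - m)%:~R * t + (theta - tau)).
  congr (_ * _); apply: eq_Rintegral => t _.
  rewrite !re_monomial !im_monomial -cosB rmorphB/=; congr cos; ring.
rewrite integral_cos_circle ?mulr0//.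
by rewrite subr_eq0; apply/eqP => e; move: m0; rewrite -e.
Qed.

(** H^2 is stable under multiplication by i. *)
Lemma L2inner_eq0 F : L2 circle F -> (forall G, hardy G -> dot circle F G = 0) ->
  forall G, hardy G -> L2inner F G = 0.
Proof.
move=> LF F0 G hG; rewrite L2innerE (F0 _ hG).
by have -> : dot circle F (monomial 0 (pi / 2) \* G) = 0 := F0 _ (hardy_shift 0 (pi / 2) hG).
Qed.

Lemma P_plusP F : L2 circle F -> hardy (P_plus F) /\
  forall G, hardy G -> dot circle (F \- P_plus F) G = 0.
Proof.
move=> LF; rewrite /P_plus; case: xgetP => [p _ [hp Fp]|].
  by split => // G hG; have := Fp G hG; rewrite L2innerE => -[].
have [p hp op] := orthogonal_projection LT sT hardy_subspace hardy_L2 hardy_complete LF.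
move=> /(_ p)[]; split => //; apply: L2inner_eq0.
  exact: (subspaceB LT LF (hardy_L2 hp)).
move=> G hG; have := op G hG; have Lp := hardy_L2 hp; have LG := hardy_L2 hG.
rewrite (semi_innerBl sT Lp LF LG) => e.
have -> : dot circle (F \- p) G = _ := semi_innerBl sT LF Lp LG.
lra.
Qed.

End Hardy.

(** * Boundary uniqueness in the Hardy space *)

Section HardyUniqueness.
Context {R : realType}.
Local Notation lambda := (@completed_lebesgue_measure R).
Local Notation E := (R[i] -> Rcomplex R).
Local Notation C := (R[i]).
Local Notation D := (angles circle : set (lebesgueType R)).
Implicit Types (A : set C) (F G u : C -> C).

Let mT := @circle_measurableT R.
Let mD := @measurable_angles_circle R.
Let LT := L2_subspace mT.
Let sT := dot_semi_inner mT.

Lemma pi2_inv_gt0 : 0 < (2 * pi)^-1 :> R.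
Proof. by rewrite invr_gt0 mulr_gt0 ?pi_gt0. Qed.

Lemma integrable_cst_circle (c : R) : lambda.-integrable D (EFin \o cst c).
Proof.
apply: measurable_bounded_integrable; [exact: mD|exact: lambda_circle_lty|exact: measurable_cst|].
by exists `|c|; split; [exact: num_real|move=> x cx t _; exact: ltW].
Qed.

Lemma square_integrable_cst (c : R) : square_integrable lambda D (cst c).
Proof. by split; [exact: measurable_cst|exact: (integrable_cst_circle (c ^+ 2))]. Qed.

Lemma square_integrable_integrable (f : R -> R) : square_integrable lambda D f ->
  lambda.-integrable D (EFin \o f).
Proof.
move=> sf; have := square_integrableM mD sf (square_integrable_cst 1).
by congr (integrable _ _ _); apply/funext => t /=; rewrite mulr1.
Qed.

(** The moments of order n and -n together isolate the real part: the sum of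
re F cos x + im F sin x and of its value at -x is 2 re F cos x. *)
Lemma re_ae0 F : L2 circle F -> (forall n theta, dot circle F (monomial n theta) = 0) ->
  {ae lambda, forall t, D t -> re F t = 0}.
Proof.
move=> LF F0; have [sre sim] := (L2P F mT).1 LF.
apply: trigonometric_uniqueness; first exact: square_integrable_integrable.
move=> n theta.
have i1 := dot_integrable mT LF (L2_monomial n theta).
have i2 := dot_integrable mT LF (L2_monomial (- n) (- theta)).
have := F0 n theta; have := F0 (- n) (- theta); rewrite /dot.
move=> /eqP; rewrite mulf_eq0 (gt_eqF pi2_inv_gt0)/= => /eqP e2.
move=> /eqP; rewrite mulf_eq0 (gt_eqF pi2_inv_gt0)/= => /eqP e1.
have := RintegralD mD i1 i2; rewrite e1 e2 addr0.
rewrite (@eq_Rintegral _ _ _ lambda D (fun t => 2 * (re F t * cos (n%:~R * t + theta)))); last first.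
  move=> t _; rewrite !re_monomial !im_monomial mulrNz mulNr -opprD cosN sinN.
  by move: (re F t) (im F t) (cos _) (sin _) => a b c s; ring.
rewrite RintegralZl; [|exact: mD|].
  by move=> /eqP; rewrite mulf_eq0 pnatr_eq0/= => /eqP.
apply: integrable_bounded; [exact: square_integrable_integrable|exact: measurable_cos_affine|exact: cos_bounded].
Qed.

Lemma fourier_ae0 F : L2 circle F -> (forall n theta, dot circle F (monomial n theta) = 0) ->
  circle_ae_eq circle F (cst 0).
Proof.
move=> LF F0; have h1 := re_ae0 LF F0.
have LF' := L2_unimodular mT (unimodular_monomial 0 (- (pi / 2)) _) LF.
have h2 : {ae lambda, forall t, D t -> re (monomial 0 (- (pi / 2)) \* F) t = 0}.
  by apply: re_ae0 LF' _ => n theta; rewrite dot_shift.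
apply: filterS2 h1 h2 => t h1 h2 Dt; have {h1} := h1 Dt; have {h2} := h2 Dt.
rewrite reM re_monomial im_monomial mul0r add0r cosN sinN cos_pihalf sin_pihalf.
by rewrite /re /im; case: (F _) => a b /=; rewrite mul0r mulN1r opprK add0r => -> ->.
Qed.

(** Subtracting the mean makes the moments of order 0 vanish as well. *)
Lemma modulus_constant (g : R -> R) : lambda.-integrable D (EFin \o g) ->
  lambda D != 0%E ->
  (forall (n : nat) theta, (0 < n)%N ->
     \int[lambda]_(t in D) (g t * cos (n%:R * t + theta)) = 0) ->
  exists c, {ae lambda, forall t, D t -> g t = c}.
Proof.
move=> ig D0 g0.
have Dfin : lambda D \is a fin_num.
  by rewrite ge0_fin_numE ?measure_ge0//; exact: lambda_circle_lty.
pose L := fine (lambda D).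
have L0 : L != 0 by rewrite /L fine_eq0.
pose c := (\int[lambda]_(t in D) g t) / L.
exists c.
have ic := integrable_cst_circle (- c).
have igc := integrable_add mD ig ic.
have icos (n theta : R) (f : R -> R) : lambda.-integrable D (EFin \o f) ->
    lambda.-integrable D (EFin \o (fun t => f t * cos (n * t + theta))).
  by move=> fi; apply: (integrable_bounded fi); [exact: measurable_cos_affine|exact: cos_bounded].
suff h (n : int) theta : \int[lambda]_(t in D) ((g t + - c) * cos (n%:~R * t + theta)) = 0.
  by apply: filterS (trigonometric_uniqueness igc h) => t h' /h' /eqP; rewrite subr_eq0 => /eqP.
rewrite (@eq_Rintegral _ _ _ lambda D (fun t => g t * cos (n%:~R * t + theta) +
   (- c) * cos (n%:~R * t + theta))); last by move=> t _; exact: mulrDl.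
have i1 := icos n%:~R theta _ ig; have i2 := icos n%:~R theta _ ic.
have i3 := icos n%:~R theta _ (integrable_cst_circle 1).
rewrite (RintegralD mD i1 i2).
have -> : \int[lambda]_(t in D) ((- c) * cos (n%:~R * t + theta)) =
    - c * \int[lambda]_(t in D) cos (n%:~R * t + theta).
  rewrite RintegralZl; [by []|exact: mD|].
  by move: i3; congr (integrable _ _ _); apply/funext => t /=; rewrite mul1r.
have [->|n0] := eqVneq n 0.
  have Ecos (t : R) : cos (0%:~R * t + theta) = cos theta by rewrite mul0r add0r.
  under eq_Rintegral do rewrite Ecos.
  under [X in _ + _ * X]eq_Rintegral do rewrite Ecos.
  rewrite RintegralZr; [|exact: mD|exact: ig].
  rewrite (@Rintegral_cst _ _ _ lambda _ mD) -/L /c.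
  by field.
rewrite (@integral_cos_circle R n theta n0) mulr0 addr0.
case: n n0 {i1 i2 i3} => [[//|m] _|m _]; first exact: g0.
rewrite -[RHS](g0 m.+1 (- theta))//; apply: eq_Rintegral => t _.
by rewrite NegzE mulrNz mulNr -cosN opprD opprK.
Qed.

Lemma Rintegral_ae_cst (X : set (lebesgueType R)) (g : R -> R) c : measurable X ->
  lambda.-integrable X (EFin \o g) -> {ae lambda, forall t, X t -> g t = c} ->
  \int[lambda]_(t in X) g t = c * fine (lambda X).
Proof.
move=> mX ig gc; rewrite -(@Rintegral_cst _ _ _ lambda _ mX); congr fine.
apply: ae_eq_integral.
- exact: mX.
- exact: (measurable_int _ ig).
- exact: measurable_cst.
- by apply: filterS gc => t h Xt /=; rewrite h.
Qed.

Section Vanishing.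
Variable A : set C.
Hypotheses (mA : circle_measurable A) (AC : A `<=` circle) (A0 : (0 < lambda (angles A))%E).

Let LA := L2_subspace mA.
Let sA := dot_semi_inner mA.

Let K : set E := [set G | hardy G /\ dot A G G = 0].

Let KL : K `<=` (L2 circle : set E).
Proof. by move=> G [hG _]; exact: hardy_L2. Qed.

Let subK : subspace K.
Proof.
split.
  split; first exact: (hardy_subspace (R := R)).1.
  exact: (semi_inner0l LA sA LA.1).
move=> a F G [hF F0] [hG G0]; split; first exact: (hardy_subspace (R := R)).2.
have LF := L2_piece mA AC (hardy_L2 hF); have LG := L2_piece mA AC (hardy_L2 hG).
have LaF := subspaceZ LA a LF.
apply/eqP; rewrite eq_le (semi_inner_ge0 sA (LA.2 a _ _ LF LG)) andbT.
apply: le_trans (normsqD_le LA sA LaF LG) _.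
by rewrite (normsqZ LA sA _ LF) F0 G0 mulr0 addr0 mulr0.
Qed.

Let shiftK (n : nat) theta F : K F -> K (monomial n theta \* F).
Proof.
move=> [hF F0]; split; first exact: hardy_shift.
by rewrite (dot_unimodular _ _ (unimodular_monomial _ _ _)).
Qed.

Lemma dot_piece_le F : L2 circle F -> dot A F F <= dot circle F F.
Proof.
move=> LF; rewrite (dotD mA LF LF) lerDl.
apply: (semi_inner_ge0 (dot_semi_inner (circle_measurableD mA))).
by apply: (L2_piece (circle_measurableD mA) _ LF) => w [].
Qed.

Let cauchyK (u : nat -> E) F : (forall n, K (u n)) -> hardy F ->
  @converges_for R E (dot circle) u F -> K F.
Proof.
move=> Ku hF uF; split => //.
have LF := L2_piece mA AC (hardy_L2 hF).
apply/eqP; rewrite eq_le (semi_inner_ge0 sA LF) andbT.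
apply/ler_addgt0Pr => e e0; rewrite add0r.
have e2 : 0 < e / 2 by lra.
have [n h] := uF _ e2; have {}h := h n (leqnn n).
have Lu := L2_piece mA AC (KL (Ku n)).
have uFle := dot_piece_le (subspaceB LT (KL (Ku n)) (hardy_L2 hF)).
have := normsqB_le LA sA LF Lu LA.1.
rewrite !subr0 (Ku n).2 addr0 (normsqBC LA sA LF Lu) => /le_trans; apply.
by have := le_lt_trans uFle h; lra.
Qed.

Let moment_zero (m : nat) F theta : K F -> dot circle F (monomial m theta) = 0.
Proof.
elim/ltn_ind: m F theta => m IH.
suff main F : K F -> dot circle F (monomial m 0) = 0.
  move=> F theta KF; have := main _ (shiftK 0 (- theta) KF).
  by rewrite dot_shift subr0 opprK add0r.
move=> KF; apply: contrapT => F1.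
have Lm := L2_monomial m (0 : R).
(* phi = w - F for w the projection of F on V: then phi is orthogonal to V and its
   m-th coefficient is that of - F *)
pose V : set E := [set G | K G /\ dot circle G (monomial m 0) = 0].
have VL : V `<=` (L2 circle : set E) by move=> G [/KL].
have sV : subspace V.
  split; first by split; [exact: subK.1|exact: (semi_inner0l LT sT Lm)].
  move=> a G G' [KG G0] [KG' G0']; split; first exact: subK.2.
  by rewrite (semi_innerP sT _ (KL KG) (KL KG') Lm) G0 G0' mulr0 addr0.
have cV : @complete_for R E (dot circle) V.
  move=> u Vu cu.
  have [G hG uG] := hardy_complete (fun n => (Vu n).1.1) cu.
  exists G => //; split; first exact: (cauchyK (fun n => (Vu n).1) hG uG).
  exact: (dot_limit mT (fun n => VL _ (Vu n)) (hardy_L2 hG) Lm uG (fun n => (Vu n).2)).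
have [w Vw wF] := orthogonal_projection LT sT sV VL cV (KL KF).
pose phi : E := w - F.
have Kphi : K phi by exact: (subspaceB subK Vw.1 KF).
have Lphi := KL Kphi.
have [sre sim] := (L2P _ mT).1 Lphi.
pose g (t : R) : R := re phi t ^+ 2 + im phi t ^+ 2.
have ig : lambda.-integrable D (EFin \o g) by exact: (integrable_add mD sre.2 sim.2).
have dotg : dot circle phi phi = (2 * pi)^-1 * \int[lambda]_(t in D) g t.
  by congr (_ * _); apply: eq_Rintegral => t _; rewrite -!expr2.
have dotgA : dot A phi phi = (2 * pi)^-1 * \int[lambda]_(t in angles A) g t.
  by congr (_ * _); apply: eq_Rintegral => t _; rewrite -!expr2.
have D0 : lambda D != 0%E.
  rewrite gt_eqF//; apply: lt_le_trans A0 _.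
  by apply: le_measure; rewrite ?inE//; exact: angles_sub.
have [|c gc] := modulus_constant ig D0.
  move=> n tau n0.
  (* the m-th coefficient of z^n phi is a coefficient of phi of index m - n < m,
   zero by induction or because phi is in H^2 *)
  have Vshift : V (monomial n tau \* phi).
    split; first exact: shiftK.
    rewrite dot_shift; have [nm|mn] := leqP n m.
      by rewrite subzn//; apply: IH Kphi; rewrite ltn_subrL n0 (leq_trans n0 nm).
    by have [_] := (hardyP _).1 Kphi.1; apply; rewrite subr_lt0.
  have := wF _ Vshift; rewrite -/phi => /eqP.
  rewrite mulf_eq0 (gt_eqF pi2_inv_gt0)/= => /eqP <-.
  apply: eq_Rintegral => t _; rewrite reM imM re_monomial im_monomial /g.
  by move: (re phi t) (im phi t) (cos _) (sin _) => a b x y; ring.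
have iA : lambda.-integrable (angles A) (EFin \o g).
  by apply: (integrableS mD mA _ ig); exact: angles_sub.
have gA : \int[lambda]_(t in angles A) g t = c * fine (lambda (angles A)).
  apply: (Rintegral_ae_cst mA iA); apply: filterS gc => t h At.
  by apply: h; exact: angles_sub At.
have c0 : c = 0.
  have := Kphi.2; rewrite dotgA gA => /eqP.
  rewrite mulf_eq0 (gt_eqF pi2_inv_gt0)/= mulf_eq0 => /orP[/eqP//|].
  rewrite fine_eq0 ?gt_eqF// ge0_fin_numE ?measure_ge0//.
  apply: le_lt_trans lambda_circle_lty.
  by apply: le_measure; rewrite ?inE//; exact: angles_sub.
have phi0 : dot circle phi phi = 0.
  rewrite dotg (_ : \int[lambda]_(t in D) g t = 0) ?mulr0//.
  by rewrite (Rintegral_ae_cst mD ig gc) c0 mul0r.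
apply: F1; have := cauchy_schwarz LT sT Lphi Lm; rewrite phi0 mul0r => h.
have /eqP : dot circle phi (monomial m 0) ^+ 2 = 0 by apply/eqP; rewrite eq_le h sqr_ge0.
rewrite sqrf_eq0 (semi_innerBl sT (VL _ Vw) (KL KF) Lm) Vw.2 sub0r oppr_eq0.
by move=> /eqP.
Qed.

(** Let [K] be the space of H^2 functions vanishing on [A].  Subtracting from an
element of [K] its projection on those with zero m-th coefficient yields
[phi] orthogonal to all its shifts, so |phi|^2 is constant; [moment_zero]
runs this by induction on m. *)
Lemma hardy_uniqueness F : hardy F -> dot A F F = 0 -> circle_ae_eq circle F (cst 0).
Proof.
move=> hF F0; apply: (fourier_ae0 (hardy_L2 hF)) => -[m|m] theta.
  exact: (@moment_zero m F theta).
by have [_] := (hardyP _).1 hF; exact.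
Qed.

End Vanishing.
End HardyUniqueness.

(** * Density on a piece of the circle, and Blaschke products *)

Section Density.
Context {R : realType}.
Local Notation lambda := (@completed_lebesgue_measure R).
Local Notation E := (R[i] -> Rcomplex R).
Local Notation C := (R[i]).
Local Notation D := (angles circle : set (lebesgueType R)).
Implicit Types (A : set C) (F G u : C -> C).

Let mT := @circle_measurableT R.
Let LT := L2_subspace mT.
Let sT := dot_semi_inner mT.

Lemma dot_ae0 A F G : circle_measurable A -> L2 A F -> L2 A G ->
  circle_ae_eq A F (cst 0) -> dot A F G = 0.
Proof.
move=> mA LF LG F0; have LA := L2_subspace mA; have sA := dot_semi_inner mA.
have FF : dot A F G = dot A (0 : E) G.
  exact: (dot_congr mA F0 (aeW _ (fun _ _ => erefl)) LF.1 LG.1 LA.1.1 LG.1).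
by rewrite FF (semi_inner0l LA sA LG).
Qed.

Lemma L2_conj A F : circle_measurable A -> L2 A F -> L2 A (conjc \o F).
Proof.
move=> mA [[mr mi] fin]; split; last first.
  apply: le_lt_trans fin; rewrite le_eqVlt; apply/orP; left; apply/eqP.
  by apply: eq_integral => t _ /=; rewrite !normc_sqr; case: (F _) => a b /=; rewrite sqrrN.
split.
  by move: mr; congr (measurable_fun _ _); apply/funext => t /=; case: (F _).
have := measurable_funN mi; congr (measurable_fun _ _); apply/funext => t /=.
by case: (F _).
Qed.

Lemma dot_conj A F G : dot A (conjc \o F) G = dot A F (conjc \o G).
Proof.
congr (_ * _); apply: eq_Rintegral => t _; rewrite /re /im /=.
by case: (F _) (G _) => a b [c d] /=; ring.
Qed.

(** If [Y] over [A] is orthogonal to H^2, the conjugate of its extension by 0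
has no coefficient of negative index, so it is in H^2 and vanishes off [A]. *)
Lemma hardy_dense A : circle_measurable A -> A `<=` circle ->
  (0 < lambda (angles (circle `\` A)))%E ->
  @dense_for R E (dot A) (L2 circle) hardy.
Proof.
move=> mA AC Ac0.
have mAc := circle_measurableD mA.
have sAT := dot_semi_inner_circle mA AC.
apply: (dense_of_orthogonal LT sAT hardy_subspace hardy_L2 (L2_complete mA AC)).
move=> Y LY Y0.
pose Y1 := vee A Y (cst 0).
have L0 : L2 (circle `\` A) (cst 0 : C -> C) by exact: (L2_subspace mAc).1.
have LY1 : L2 circle Y1 := L2_vee mA (L2_piece mA AC LY) L0.
have Y1A t : angles A t -> Y1 (expi t) = Y (expi t).
  by move=> [_ At]; rewrite /Y1 /vee mem_set.
have Y1Ac t : angles (circle `\` A) t -> Y1 (expi t) = 0.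
  by move=> [_ [_ At]]; rewrite /Y1 /vee memNset.
have Y1dot G : L2 circle G -> dot circle Y1 G = dot A Y G.
  move=> LG; rewrite (dotD mA LY1 LG) (dot_eq (F' := Y) (G' := G) Y1A (fun _ _ => erefl)).
  rewrite (dot_eq (A := circle `\` A) (F' := cst 0) (G' := G) Y1Ac (fun _ _ => erefl)).
  have LGc := L2_sub mAc mT (fun w h => h.1) LG.
  by rewrite (semi_inner0l (L2_subspace mAc) (dot_semi_inner mAc) LGc) addr0.
(* conjugation exchanges the coefficients of index n and - n *)
pose F := conjc \o Y1.
have LF : L2 circle F := L2_conj mT LY1.
have hF : hardy F.
  apply/hardyP; split => // -[//|n] _ theta.
  rewrite /F dot_conj.
  rewrite (dot_eq (A := circle) (F' := Y1) (G' := monomial n.+1%:Z (- theta)) (fun _ _ => erefl)); last first.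
    move=> t _; rewrite /= !monomialE expi_conj; congr expi.
    by rewrite NegzE mulrNz; ring.
  have hm := hardy_monomial n.+1 (- theta).
  by rewrite (Y1dot _ (hardy_L2 hm)) (Y0 _ hm).
have F0 : dot (circle `\` A) F F = 0.
  rewrite (dot_eq (A := circle `\` A) (F' := cst 0) (G' := cst 0)).
  - exact: (semi_inner0l (L2_subspace mAc) (dot_semi_inner mAc) L0).
  - by move=> t At; rewrite /F /= Y1Ac//= oppr0.
  - by move=> t At; rewrite /F /= Y1Ac//= oppr0.
have AcC : circle `\` A `<=` circle by move=> w [].
have Fae := hardy_uniqueness mAc AcC Ac0 hF F0.
have FF := dot_ae0 mT LF LF Fae.
apply/eqP; rewrite eq_le (semi_inner_ge0 sAT LY) andbT.
rewrite -(dot_eq Y1A Y1A).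
apply: le_trans (dot_piece_le mA LY1) _.
move: FF; rewrite /F dot_conj => <-.
rewrite le_eqVlt; apply/orP; left; apply/eqP; apply: dot_eq => // t _ /=.
by rewrite conjcK.
Qed.

End Density.

Section Blaschke.
Context {R : realType}.
Local Notation C := (R[i]).
Implicit Types (A : set C) (F G u : C -> C).

(** A class closed under the operations that build a Blaschke product,
inverses included, and contained in the measurable functions. *)
Definition circle_continuous F := continuous (re F) /\ continuous (im F).

Lemma circle_continuous_measurable A F : circle_continuous F -> circle_measurable_fun A F.
Proof. by move=> [cr ci]; split; exact: continuous_lebesgue_measurable. Qed.

Lemma circle_continuous_cst (c : C) : circle_continuous (cst c).
Proof. by split => t; exact: cvg_cst. Qed.

Lemma circle_continuous_id : circle_continuous id.
Proof. by split; [exact: continuous_cos|exact: continuous_sin]. Qed.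

Lemma circle_continuousM F G : circle_continuous F -> circle_continuous G ->
  circle_continuous (F \* G).
Proof.
move=> [rF iF] [rG iG]; split.
  rewrite (_ : re _ = fun t => re F t * re G t - im F t * im G t); last first.
    by apply/funext => t; rewrite reM.
  by move=> t; apply: cvgB; apply: cvgM; [exact: rF|exact: rG|exact: iF|exact: iG].
rewrite (_ : im _ = fun t => re F t * im G t + im F t * re G t); last first.
  by apply/funext => t; rewrite imM.
by move=> t; apply: cvgD; apply: cvgM; [exact: rF|exact: iG|exact: iF|exact: rG].
Qed.

Lemma circle_continuousB F G : circle_continuous F -> circle_continuous G ->
  circle_continuous (F \- G).
Proof.
move=> [rF iF] [rG iG]; split.
  rewrite (_ : re _ = fun t => re F t - re G t); last by apply/funext => t; exact: reB.
  by move=> t; apply: cvgB; [exact: rF|exact: rG].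
rewrite (_ : im _ = fun t => im F t - im G t); last by apply/funext => t; exact: imB.
by move=> t; apply: cvgB; [exact: iF|exact: iG].
Qed.

Lemma circle_continuousV F : circle_continuous F -> (forall t : R, F (expi t) != 0) ->
  circle_continuous (fun w => (F w)^-1).
Proof.
move=> [rF iF] F0.
have n0 t : re F t ^+ 2 + im F t ^+ 2 != 0.
  rewrite paddr_eq0 ?sqr_ge0// !sqrf_eq0; have := F0 t.
  by rewrite /re /im; case: (F _) => a b; rewrite eq_complex.
have cn : continuous (fun t => (re F t ^+ 2 + im F t ^+ 2)^-1).
  move=> t; apply: cvgV; first exact: n0.
  by apply: cvgD; rewrite expr2; under eq_fun do rewrite expr2; apply: cvgM; [exact: rF|exact: rF|exact: iF|exact: iF].
split.
  rewrite (_ : re _ = fun t => re F t * (re F t ^+ 2 + im F t ^+ 2)^-1); last first.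
    by apply/funext => t; rewrite /re /im; case: (F _).
  by move=> t; apply: cvgM; [exact: rF|exact: cn].
rewrite (_ : im _ = fun t => - (im F t * (re F t ^+ 2 + im F t ^+ 2)^-1)); last first.
  by apply/funext => t; rewrite /re /im; case: (F _).
by move=> t; apply: cvgN; apply: cvgM; [exact: iF|exact: cn].
Qed.

Lemma blaschke_denominator_neq0 (z : C) (t : R) : `|z| < 1 -> 1 - conjc z * expi t != 0.
Proof.
move=> z1; rewrite subr_eq0; apply/eqP => e.
have := congr1 Num.norm e; rewrite normr1 normrM.
have -> : `|expi t| = 1 by exact: expi_circle.
have -> : `|conjc z| = `|z| by rewrite !normc_def; case: (z) => a b /=; rewrite sqrrN.
by rewrite mulr1 => e1; move: z1; rewrite -e1 ltxx.
Qed.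

(** For |w| = 1, |w - z|^2 and |1 - conj z w|^2 are both
1 - 2 Re (conj z w) + |z|^2. *)
Lemma unimodular_blaschke A (phi0 : R) N (z : 'I_N -> C) : (forall j, `|z j| < 1) ->
  unimodular A (blaschke phi0 z).
Proof.
move=> z1; rewrite /blaschke.
have fac j : circle_continuous (fun w => (w - z j) / (1 - conjc (z j) * w)) /\
    forall t, Normc.normc ((expi t - z j) / (1 - conjc (z j) * expi t)) = 1.
  have den t := @blaschke_denominator_neq0 (z j) t (z1 j).
  have cden : circle_continuous (fun w => 1 - conjc (z j) * w).
    apply: (@circle_continuousB (cst 1) (cst (conjc (z j)) \* id)).
      exact: circle_continuous_cst.
    by apply: circle_continuousM; [exact: circle_continuous_cst|exact: circle_continuous_id].
  split.
    apply: (@circle_continuousM (id \- cst (z j)) (fun w => (1 - conjc (z j) * w)^-1)).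
      by apply: circle_continuousB; [exact: circle_continuous_id|exact: circle_continuous_cst].
    exact: circle_continuousV.
  move=> t; set a := expi t - z j; set d := 1 - _ * _.
  have d0 : d != 0 by exact: den.
  have ad : Normc.normc a = Normc.normc d.
    rewrite /a /d /expi; case: (z j) => x y /=; congr Num.sqrt.
    have := cos2Dsin2 t; move: (cos t) (sin t) => c s cs.
    transitivity ((c ^+ 2 + s ^+ 2) - 2 * (c * x + s * y) + x ^+ 2 + y ^+ 2); first by ring.
    transitivity (1 - 2 * (c * x + s * y) + (x ^+ 2 + y ^+ 2) * (c ^+ 2 + s ^+ 2)); last by ring.
    by rewrite cs; ring.
  have nd : Normc.normc d != 0.
    by apply/eqP => /Normc.eq0_normc d00; move: d0; rewrite d00 eqxx.
  apply: (mulIf nd); rewrite -Normc.normcM divfK// mul1r.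
  exact: ad.
have [cb b1] : circle_continuous (fun w => \prod_(j < N) ((w - z j) / (1 - conjc (z j) * w))) /\
    forall t, Normc.normc (\prod_(j < N) ((expi t - z j) / (1 - conjc (z j) * expi t))) = 1.
  elim: (index_enum _) => [|j s [cs s1]].
    split => [|t]; last by rewrite big_nil Normc.normc1.
    by under eq_fun do rewrite big_nil; exact: circle_continuous_cst.
  split => [|t]; last by rewrite big_cons Normc.normcM (fac j).2 mul1r s1.
  under eq_fun do rewrite big_cons.
  exact: (circle_continuousM (fac j).1 cs).
split; first exact: (circle_continuous_measurable _ (circle_continuousM (circle_continuous_cst _) cb)).
by move=> t _; rewrite Normc.normcM b1 mulr1 /expi/= cos2Dsin2 sqrtr1.
Qed.

End Blaschke.

(** * From the Toeplitz equation to the normal equations *)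

Section Assembly.
Context {R : realType}.
Local Notation lambda := (@completed_lebesgue_measure R).
Local Notation E := (R[i] -> Rcomplex R).
Local Notation C := (R[i]).
Implicit Types (A : set C) (F G u : C -> C).

Let mT := @circle_measurableT R.
Let LT := L2_subspace mT.
Let sT := dot_semi_inner mT.

Lemma scale_funE (a : R) F : a%:C%C \*o F = (a *: (F : E)) :> (C -> C).
Proof.
apply/funext => w; rewrite [RHS]/(scalec a (F w)) /=.
by case: (F w) => x y /=; congr (_ +i* _)%C; rewrite !mul0r ?subr0 ?addr0.
Qed.

Lemma unimodular_conj A u : unimodular A u -> unimodular A (conjc \o u).
Proof.
move=> [[mr mi] u1]; split.
  split.
    by move: mr; congr (measurable_fun _ _); apply/funext => t /=; case: (u _).
  have := measurable_funN mi; congr (measurable_fun _ _); apply/funext => t /=.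
  by case: (u _).
by move=> t At; rewrite -(u1 t At) /=; case: (u _) => a b /=; rewrite sqrrN.
Qed.

Lemma unimodular_sub A B u : circle_measurable B -> A `<=` B ->
  unimodular B u -> unimodular A u.
Proof.
move=> mB AB [[mr mi] u1].
have sAB : angles A `<=` angles B by move=> t [? /AB].
split; first by split; [exact: measurable_funS mr|exact: measurable_funS mi].
by move=> t At; exact: u1 (sAB t At).
Qed.

Lemma unimodular_mulJ A u t : unimodular A u -> angles A t ->
  u (expi t) * conjc (u (expi t)) = 1.
Proof.
move=> [_ u1] At; have := normc_sqr (u (expi t)); rewrite u1// expr1n.
by case: (u _) => a b /= e; congr (_ +i* _)%C; [rewrite mulrN opprK -!expr2|ring].
Qed.

Section Problem.
Variables I J : set C.
Hypotheses (hI : I `<=` circle) (hJ : J = circle `\` I).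
Hypotheses (mI : circle_measurable I) (mJ : circle_measurable J).
Variables (psi b h f : C -> C).
Hypotheses (Lpsi : L2 circle psi) (ub : unimodular circle b).
Hypotheses (Lh : L2 J h) (Lf : L2 I f).

Let JC : J `<=` circle. Proof. by rewrite hJ => w []. Qed.

Let target_I : C -> C := (conjc \o b) \* (f \- psi).
Let target_J : C -> C := (conjc \o b) \* (h \- psi).
(** The function that b^-1 (f - psi) and b^-1 (h - psi) define on the circle,
since b^-1 = conj b there; in these terms the data of the problem no longer
involve psi and b. *)
Definition target : C -> C := vee I target_I target_J.

Lemma L2_target_I : L2 I target_I.
Proof.
apply: (L2_unimodular mI (unimodular_conj (unimodular_sub mT hI ub))).
exact: (subspaceB (L2_subspace mI) Lf (L2_piece mI hI Lpsi)).
Qed.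

Lemma L2_target_J : L2 J target_J.
Proof.
apply: (L2_unimodular mJ (unimodular_conj (unimodular_sub mT JC ub))).
exact: (subspaceB (L2_subspace mJ) Lh (L2_piece mJ JC Lpsi)).
Qed.

Lemma L2_target : L2 circle target.
Proof. by apply: (L2_vee mI L2_target_I); rewrite -hJ; exact: L2_target_J. Qed.

Lemma vee_I u v t : angles I t -> vee I u v (expi t) = u (expi t).
Proof. by move=> [_ It]; rewrite /vee mem_set. Qed.

Lemma vee_J u v t : angles J t -> vee I u v (expi t) = v (expi t).
Proof. by rewrite hJ => -[_ [_ It]]; rewrite /vee memNset. Qed.

Let residual_eq A u g t : unimodular A b -> angles A t ->
  target (expi t) = ((conjc \o b) \* (u \- psi)) (expi t) ->
  (psi \+ b \* g \- u) (expi t) = (b \* (g - target : E)) (expi t).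
Proof.
move=> ubA At e; rewrite /= -[X in _ = _ * X]/(g (expi t) - target (expi t)) e /=.
rewrite mulrBr mulrA (unimodular_mulJ ubA At); ring.
Qed.

Lemma residual_I g : dot I (psi \+ b \* g \- f) (psi \+ b \* g \- f) =
  dot I (g - target : E) (g - target : E).
Proof.
have ubI := unimodular_sub mT hI ub.
rewrite -[RHS](dot_unimodular _ _ ubI).
by apply: dot_eq => t It; apply: (residual_eq _ ubI It); exact: vee_I.
Qed.

Lemma residual_J g : dot J (psi \+ b \* g \- h) (psi \+ b \* g \- h) =
  dot J (g - target : E) (g - target : E).
Proof.
have ubJ := unimodular_sub mT JC ub.
rewrite -[RHS](dot_unimodular _ _ ubJ).
by apply: dot_eq => t Jt; apply: (residual_eq _ ubJ Jt); exact: vee_J.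
Qed.

Lemma dot_IJ F G : L2 circle F -> L2 circle G -> dot circle F G = dot I F G + dot J F G.
Proof. by move=> LF LG; rewrite (dotD mI LF LG) hJ. Qed.

Lemma L2_indicator_J F : L2 circle F -> L2 circle (\1_J \* F).
Proof.
move=> LF; have L0 : L2 I (cst 0 : C -> C) by exact: (L2_subspace mI).1.
have LJ : L2 (circle `\` I) F by rewrite -hJ; exact: L2_piece.
apply: L2_eq (L2_vee mI L0 LJ); first exact: mT.
move=> t [t2 ct]; rewrite /vee /= indicE hJ.
have [It|It] := pselect (I (expi t)).
  by rewrite mem_set// memNset ?mul0r// => -[].
by rewrite memNset// mem_set ?mul1r.
Qed.

Lemma dot_indicator_J F G : L2 circle F -> L2 circle G ->
  dot circle (\1_J \* F) G = dot J F G.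
Proof.
move=> LF LG; rewrite (dot_IJ (L2_indicator_J LF) LG).
rewrite (dot_eq (A := I) (F' := cst 0) (G' := G)) ?(semi_inner0l (L2_subspace mI) (dot_semi_inner mI) (L2_piece mI hI LG)) ?add0r.
- apply: dot_eq => // t [_ Jt]; rewrite /= indicE mem_set ?mul1r//.
- move=> t [_ It]; rewrite /= indicE memNset ?mul0r// hJ => -[_]; exact.
- by [].
Qed.

Lemma dot_P_plus F G : L2 circle F -> hardy G -> dot circle (P_plus F) G = dot circle F G.
Proof.
move=> LF hG; have [hP PF] := P_plusP LF.
have := PF G hG; have LG := hardy_L2 hG; have LP := hardy_L2 hP.
have -> : dot circle (F \- P_plus F) G = _ := semi_innerBl sT LF LP LG.
lra.
Qed.

Section Equation.
Variable mu : R.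
Let rhs : C -> C := vee I target_I ((1 + mu)%:C%C \*o target_J).
Let T g : C -> C := g \+ mu%:C%C \*o toeplitz J g.

Let L2_rhs : L2 circle rhs.
Proof.
apply: (L2_vee mI L2_target_I); rewrite -hJ scale_funE.
exact: (subspaceZ (L2_subspace mJ) (1 + mu) L2_target_J).
Qed.

Let dot_rhs G : L2 circle G -> dot circle rhs G = dot I target G + (1 + mu) * dot J target G.
Proof.
move=> LG; rewrite (dot_IJ L2_rhs LG); congr (_ + _).
  by apply: dot_eq => // t It; rewrite /rhs /target !vee_I.
have LtJ := L2_piece mJ JC L2_target; have LGJ := L2_piece mJ JC LG.
rewrite -(semi_innerZl (L2_subspace mJ) (dot_semi_inner mJ) (1 + mu) LtJ LGJ).
rewrite -[_ *: _](scale_funE (1 + mu) target).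
by apply: dot_eq => // t Jt; rewrite /rhs /target /= !vee_J.
Qed.

Let residual g : E := T g - P_plus rhs.

Let residual_hardy g : hardy g -> hardy (residual g).
Proof.
move=> hg; have hs := @hardy_subspace R.
have hP := (P_plusP L2_rhs).1.
have ht := (P_plusP (L2_indicator_J (hardy_L2 hg))).1.
apply: (subspaceB hs _ hP); rewrite /T scale_funE.
exact: (subspaceD hs hg (subspaceZ hs mu ht)).
Qed.

Let dot_residual g v : hardy g -> hardy v -> dot circle (residual g) v =
  dot I (g - target : E) v + (1 + mu) * dot J (g - target : E) v.
Proof.
move=> hg hv; have Lg := hardy_L2 hg; have Lv := hardy_L2 hv.
have hP := (P_plusP L2_rhs).1; have ht := (P_plusP (L2_indicator_J Lg)).1.
have Lt := hardy_L2 ht; have LP := hardy_L2 hP.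
have -> : residual g = ((mu *: (toeplitz J g : E) + (g : E)) - P_plus rhs).
  rewrite /residual /T scale_funE; congr (_ - _).
  by rewrite addrC.
rewrite (semi_innerBl sT (LT.2 mu _ _ Lt Lg) LP Lv) (semi_innerP sT mu Lt Lg Lv).
rewrite (dot_P_plus L2_rhs hv) (dot_rhs Lv).
rewrite /toeplitz (dot_P_plus (L2_indicator_J Lg) hv) (dot_indicator_J Lg Lv).
rewrite (dot_IJ Lg Lv).
rewrite (semi_innerBl (dot_semi_inner_circle mI hI) Lg L2_target Lv).
rewrite (semi_innerBl (dot_semi_inner_circle mJ JC) Lg L2_target Lv).
ring.
Qed.

(** The difference of the two sides is an element of H^2 whose product with v in
H^2 is the left-hand side of the normal equation for v, because P_+ is
self-adjoint; it is null iff all these products vanish. *)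
Lemma toeplitz_equation g : hardy g ->
  circle_ae_eq circle (T g) (P_plus rhs) <->
  normal_eq (hardy : set E) (dot I) (dot J) target (1 + mu) g.
Proof.
move=> hg; have hr := residual_hardy hg; have Lr := hardy_L2 hr.
have res0 : circle_ae_eq circle (T g) (P_plus rhs) <-> circle_ae_eq circle (residual g) (cst 0).
  split; apply: filterS => t ht Dt.
    rewrite -[LHS]/(T g (expi t) - P_plus rhs (expi t)) ht// subrr//.
  by apply/eqP; rewrite -subr_eq0; apply/eqP; exact: ht.
split.
  move=> /res0 r0; split => // v hv.
  by rewrite -dot_residual//; exact: (dot_ae0 mT Lr (hardy_L2 hv) r0).
move=> [_ ng]; apply/res0; apply: (dot_eq0 mT Lr).
by rewrite dot_residual//; exact: ng.
Qed.

(** [hardy_inv] picks some solution of the equation as soon as there is one. *)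
Lemma hardy_inv_normal_eq :
  (exists g, normal_eq (hardy : set E) (dot I) (dot J) target (1 + mu) g) ->
  normal_eq (hardy : set E) (dot I) (dot J) target (1 + mu) (hardy_inv T (P_plus rhs)).
Proof.
move=> [g ng]; rewrite /hardy_inv; case: xgetP => [g' _ [hg' Tg']|/(_ g)].
  exact/toeplitz_equation.
by case; split; [exact: ng.1|exact: (toeplitz_equation ng.1).2 ng].
Qed.

End Equation.

End Problem.
End Assembly.

(** * The extremal problem on the circle *)

Theorem theorem2 (R : realType) (I J : set R[i])
    (hI : I `<=` circle) (hJ : J = circle `\` I)
    (mI : circle_measurable I) (mJ : circle_measurable J)
    (I0 : (0 < circle_measure I)%E) (J0 : (0 < circle_measure J)%E)
    (N : nat) (z omega : 'I_N -> R[i])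
    (z_inj : injective z) (z_disk : forall j, `|z j| < 1)
    (psi : R[i] -> R[i]) (psi_hardy : hardy psi)
    (psi_interp : forall j, hardy_eval psi (z j) = omega j)
    (phi0 : R) (hphi0 : 0 <= phi0 <= 2 * pi)
    (M : R) (M0 : 0 < M)
    (h : R[i] -> R[i]) (hL2 : L2 J h)
    (f : R[i] -> R[i]) (fL2 : L2 I f)
    (hf : ~ trace I (Apsib psi (blaschke phi0 z)) f) :
  let b := blaschke phi0 z in
  let bbar := conjc \o b in
  let g0 (mu : R) :=
    hardy_inv (fun g => g \+ mu%:C%C \*o toeplitz J g)
      (P_plus (vee I (bbar \* (f \- psi))
                     ((1 + mu)%:C%C \*o (bbar \* (h \- psi))))) in
  exists mu : R,
    [/\ -1 < mu,
        L2norm J (psi \+ b \* g0 mu \- h) = M,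
        forall mu' : R, -1 < mu' ->
          L2norm J (psi \+ b \* g0 mu' \- h) = M -> mu' = mu,
        BEP_solution I J psi b M h f (g0 mu)
      & forall g, BEP_solution I J psi b M h f g -> circle_ae_eq circle g (g0 mu)].
Proof.
move=> b bbar g0.
pose E : lmodType R := (R[i] -> Rcomplex R : lmodType R).
have mT := @circle_measurableT R.
have LT := L2_subspace mT.
have hs := @hardy_subspace R.
have JC : J `<=` circle by rewrite hJ => w [].
have ub : unimodular circle b by exact: unimodular_blaschke.
have Lpsi := hardy_L2 psi_hardy.
pose k : E := target I psi b h f.
have Lk : L2 circle k := L2_target hI hJ mI mJ Lpsi ub hL2 fL2.
have sI := dot_semi_inner_circle mI hI; have sJ := dot_semi_inner_circle mJ JC.
have resI (g : R[i] -> R[i]) : dot I (psi \+ b \* g \- f) (psi \+ b \* g \- f) =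
    dot I (g - k : E) (g - k : E) by exact: residual_I.
have resJ (g : R[i] -> R[i]) : dot J (psi \+ b \* g \- h) (psi \+ b \* g \- h) =
    dot J (g - k : E) (g - k : E) by exact: residual_J.
have posmeas A : (0 < circle_measure A)%E -> (0 < completed_lebesgue_measure (angles A))%E.
  rewrite /circle_measure pmule_rgt0// lte_fin; exact: pi2_inv_gt0.
have dI : @dense_for R E (dot I) (L2 circle) hardy.
  by apply: (hardy_dense mI hI); rewrite -hJ; exact: posmeas.
have dJ : @dense_for R E (dot J) (L2 circle) hardy.
  have JJ : circle `\` J = I by rewrite hJ setDD setIC; apply/setIidPl.
  by apply: (hardy_dense mJ JC); rewrite JJ; exact: posmeas.
have compV : @complete_for R E (fun F G => dot I F G + dot J F G) hardy.
  have e (F G : E) : hardy F -> hardy G -> dot circle (F - G) (F - G) =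
      dot I (F - G) (F - G) + dot J (F - G) (F - G).
    move=> hF hG; have LFG := subspaceB LT (hardy_L2 hF) (hardy_L2 hG).
    exact: (dot_IJ hJ mI LFG LFG).
  move=> u hu cu; have [|F hF uF] := hardy_complete hu.
    move=> d /cu[n0 hn]; exists n0 => m n hm hn'; rewrite (e _ _ (hu m) (hu n)).
    exact: hn.
  exists F => // d /uF[n0 hn]; exists n0 => n hn'; rewrite -(e _ _ (hu n) hF).
  exact: hn.
have hk : ~ (exists2 v : E, hardy v & dot I (v - k) (v - k) = 0).
  move=> [v hv v0]; apply: hf.
  exists (psi \+ b \* v); first by exists v.
  have LF : L2 I (psi \+ b \* v \- f).
    apply: (subspaceB (L2_subspace mI) _ fL2).
    apply: (subspaceD (L2_subspace mI) (L2_piece mI hI Lpsi)).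
    exact: (L2_unimodular mI (unimodular_sub mT hI ub) (L2_piece mI hI (hardy_L2 hv))).
  have := dot_eq0 mI LF; rewrite resI => /(_ v0).
  apply: filterS => t ht It; apply/esym/eqP; rewrite -subr_eq0; apply/eqP.
  exact: ht It.
have ng mu : -1 < mu -> normal_eq (hardy : set E) (dot I) (dot J) k (1 + mu) (g0 mu).
  move=> mu1; apply: (hardy_inv_normal_eq hI hJ mI mJ Lpsi ub hL2 fL2).
  apply: (normal_eq_exists LT hs (@hardy_L2 R) sI sJ Lk compV); lra.
have normJ (g : R[i] -> R[i]) : hardy g -> (L2norm J (psi \+ b \* g \- h) = M) <->
    dot J (g - k : E) (g - k : E) = M ^+ 2.
  move=> hg; rewrite L2normE resJ.
  have d0 : 0 <= dot J (g - k : E) (g - k : E).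
    by apply: (semi_inner_ge0 sJ); exact: (subspaceB LT (hardy_L2 hg) Lk).
  split=> [<-|->]; first by rewrite sqr_sqrtr.
  by rewrite sqrtr_sqr ger0_norm// ltW.
have extremalP (g : R[i] -> R[i]) : BEP_solution I J psi b M h f g <->
    extremal (hardy : set E) (dot I) (dot J) k M g.
  have nJ (g' : R[i] -> R[i]) : L2norm J (psi \+ b \* g' \- h) <= M <->
      dot J (g' - k : E) (g' - k : E) <= M ^+ 2.
    rewrite L2normE resJ -(ler_sqrt _ (ltW (exprn_gt0 2 M0))) sqrtr_sqr.
    by rewrite (ger0_norm (ltW M0)).
  have nI (g' g'' : R[i] -> R[i]) : hardy g'' ->
      L2norm I (psi \+ b \* g' \- f) <= L2norm I (psi \+ b \* g'' \- f) <->
      dot I (g' - k : E) (g' - k : E) <= dot I (g'' - k : E) (g'' - k : E).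
    move=> hg; rewrite !L2normE !resI ler_sqrt//.
    by apply: (semi_inner_ge0 sI); exact: (subspaceB LT (hardy_L2 hg) Lk).
  split=> [[[hg gM] gmin]|[hg gM gmin]]; split.
  - exact: hg.
  - exact/nJ.
  - by move=> g' hg' /nJ g'M; apply/(nI _ _ hg')/gmin.
  - by split => //; exact/nJ.
  - by move=> g' [hg' /nJ g'M]; apply/(nI _ _ hg')/gmin.
have [l l0 hl] := normal_eq_saturates LT hs (@hardy_L2 R) sI sJ Lk compV dI dJ M0 hk.
pose mu := l - 1.
have mu1 : -1 < mu by rewrite /mu; lra.
have muE : 1 + mu = l by rewrite /mu; lra.
have ngmu := ng mu mu1; rewrite muE in ngmu.
have satmu := hl _ ngmu.
exists mu; split.
- exact: mu1.
- by apply/normJ; [exact: ngmu.1|].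
- move=> mu' mu'1 /(normJ _ (ng _ mu'1).1) sat'.
  apply: contrapT => /eqP mu'mu.
  have ll' : 1 + mu' != l by rewrite -muE (inj_eq (addrI 1)).
  have l'0 : 0 < 1 + mu' by rewrite addrC -ltrBlDr sub0r.
  have zero := residual_injective LT hs (@hardy_L2 R) sI sJ Lk dJ l'0 l0 ll'
    (ng _ mu'1) ngmu (etrans sat' (esym satmu)).
  have /eqP : M ^+ 2 = 0 := etrans (esym sat') zero.
  by rewrite expf_eq0/= (gt_eqF M0).
- apply/extremalP.
  exact: (normal_eq_extremal LT hs (@hardy_L2 R) sI sJ Lk l0 ngmu satmu).
- move=> g /extremalP exg.
  have [d1 d2] := extremal_unique LT hs (@hardy_L2 R) sI sJ Lk l0 ngmu satmu exg.
  have hgg : hardy (g - g0 mu : E) by case: exg => hg _ _; exact: (subspaceB hs hg ngmu.1).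
  have Lgg := hardy_L2 hgg.
  have : dot circle (g - g0 mu : E) (g - g0 mu : E) = 0.
    by rewrite (dot_IJ hJ mI Lgg Lgg) d1 d2 addr0.
  move=> /(dot_eq0 mT Lgg); apply: filterS => t ht Dt.
  by apply/eqP; rewrite -subr_eq0; apply/eqP; exact: ht Dt.
Qed.
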